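(* Let $d\ge1$. Let $x_1,\dots,x_{d-1}$ be $d$-th roots of unity with $x_i=x_1^i$ for $1\le i\le d-1$, let $z=-\frac{1}{u+1}$, and let ${\rm tr}$ be the Markov trace on $\bigcup_{m\ge1}{\rm Y}_{d,m}(u)$ with these parameters. For a classical braid $\alpha\in B_n$ with closure $\hat\alpha$ put $$V_{d,S}(u)(\hat\alpha):=\left(-\frac{1+u}{\sqrt u}\right)^{n-1}\left(\sqrt u\right)^{\varepsilon(\alpha)}{\rm tr}(\delta(\alpha)),$$ and for a framed braid $\alpha\in\mathcal{F}_n$ with closure the framed link $\hat\alpha$ put $$\mathcal{V}_{d,S}(u)(\hat\alpha):=\left(-\frac{1+u}{\sqrt u}\right)^{n-1}\left(\sqrt u\right)^{\varepsilon(\alpha)}{\rm tr}(\gamma(\alpha)).$$ Then the invariants $V_{d,S}(u)$ of classical links coincide with the Jones polynomial $V(u)$, i.e. $V_{d,S}(u)(\hat\alpha)=V(u)(\hat\alpha)$ for all $n\ge1$ and all $\alpha\in B_n$. The invariants $\mathcal{V}_{d,S}(u)$ of framed links are analogues of the Jones polynomial in the framed category.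
   Context: Let $u$ be an indeterminate and $K=\mathbb{C}(u)$, and fix a square root $\sqrt u$ of $u$ in an extension field. $B_n$ is the braid group with generators $\sigma_1,\dots,\sigma_{n-1}$. The framed braid group is $\mathcal{F}_n=\mathbb{Z}^n\rtimes B_n$, where $\mathbb{Z}^n$ is written multiplicatively with standard generators $t_1,\dots,t_n$ (the framing generators) and $\sigma_it_j=t_{s_i(j)}\sigma_i$ with $s_i=(i,i+1)$; its elements are braids with an integer framing attached to each strand, and their closures are framed links. For $\alpha$ in $B_n$ or $\mathcal{F}_n$, $\varepsilon(\alpha)$ is the algebraic sum of the exponents of the $\sigma_i$'s in $\alpha$. Here $S\subset\mathbb{Z}/d\mathbb{Z}$ is the one-element subset which labels the chosen values $(x_1,\dots,x_{d-1})$ (namely $S=\{m\}$ when $x_\ell=\cos\frac{2\pi m\ell}{d}+i\sin\frac{2\pi m\ell}{d}$). The Yokonuma--Hecke algebra ${\rm Y}_{d,n}(u)$ is the associative unital $K$-algebra generated by $g_1,\dots,g_{n-1},t_1,\dots,t_n$ subject to: $g_ig_j=g_jg_i$ for $|i-j|>1$; $g_{i+1}g_ig_{i+1}=g_ig_{i+1}g_i$; $g_i^2=1+(u-1)e_i+(u-1)e_ig_i$; $t_it_j=t_jt_i$ for all $i,j$; $t_i^d=1$; $g_it_i=t_{i+1}g_i$; $g_it_{i+1}=t_ig_i$; $g_it_j=t_jg_i$ for $j\ne i,i+1$; where $e_i:=\frac1d\sum_{s=0}^{d-1}t_i^st_{i+1}^{-s}$. One regards ${\rm Y}_{d,n}(u)\subset{\rm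 Y}_{d,n+1}(u)$. The map $\delta:\mathbb{C}B_n\to{\rm Y}_{d,n}(u)$ is the natural algebra homomorphism with $\sigma_i\mapsto g_i$, and $\gamma:\mathbb{C}\mathcal{F}_n\to{\rm Y}_{d,n}(u)$ is the natural algebra homomorphism with $\sigma_i\mapsto g_i$, $t_j\mapsto t_j$. Markov trace (a known theorem of Juyumaya): for given parameters $z,x_1,\dots,x_{d-1}$ there is a unique linear map ${\rm tr}$ on $\bigcup_{m\ge1}{\rm Y}_{d,m}(u)$ such that, for all $m$ and all $a,b\in{\rm Y}_{d,m}(u)$: ${\rm tr}(ab)={\rm tr}(ba)$; ${\rm tr}(1)=1$; ${\rm tr}(ag_m)=z\,{\rm tr}(a)$; ${\rm tr}(at_{m+1}^s)=x_s{\rm tr}(a)$ for $s=1,\dots,d-1$. The Iwahori--Hecke algebra ${\rm H}_n(u)$ is the $K$-algebra generated by $h_1,\dots,h_{n-1}$ subject to the braid relations and $h_i^2=(u-1)h_i+u$; $\pi:\mathbb{C}B_n\to{\rm H}_n(u)$ is the algebra homomorphism with $\sigma_i\mapsto h_i$. For $\zeta\in K^\times$ the Ocneanu trace $\tau$ is the unique linear trace on $\bigcup_n{\rm H}_n(u)$ with $\tau(ab)=\tau(ba)$, $\tau(1)=1$, $\tau(ah_n)=\zeta\,\tau(a)$ for $a,b\in{\rm H}_n(u)$. The Jones polynomial is $$V(u)(\hat\alpha)=\left(-\frac{1+u}{\sqrt u}\right)^{n-1}\left(\sqrt u\right)^{\varepsilon(\alpha)}\tau(\pi(\alpha)),\qquad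 \alpha\in B_n,$$ with $\zeta=-\frac{1}{u+1}$. *)

(* Defs.v *)
From HB Require Import structures.
From mathcomp Require Import all_boot all_order all_algebra perm.
From mathcomp Require Import boolp reals.
From mathcomp Require Import complex zify ring.

Set Implicit Arguments.
Unset Strict Implicit.
Unset Printing Implicit Defensive.

Import GRing.Theory.

Local Open Scope ring_scope.
Local Open Scope quotient_scope.

(* Groups given by generators and relations.  [P G f] says that the family    *)
(* [f] of elements of the group [G] satisfies the relations; [P] must be a    *)
(* conjunction of equations.  Two words (the boolean marks an inverse) are    *)
(* identified when they agree in every group satisfying the relations, so     *)
(* that the quotient has the universal property [glift] by construction.      *)

Definition group_relations (X : Type) := forall G : groupType, (X -> G) -> Prop.

Section PresentedGroup.
Variables (X : choiceType) (P : group_relations X).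

Definition weval (G : groupType) (f : X -> G) (w : seq (X * bool)) : G :=
  (\prod_(x <- w) (if x.2 then (f x.1)^-1 else f x.1))%g.

Definition gcong (v w : seq (X * bool)) : bool :=
  `[< forall (G : groupType) (f : X -> G), P f -> weval f v = weval f w >].

Lemma gcong_refl : reflexive gcong.
Proof. by move=> w; apply/asboolP. Qed.
Lemma gcong_sym : symmetric gcong.
Proof.
by move=> v w; apply/asboolP/asboolP => h G f Pf; symmetry; apply: h.
Qed.
Lemma gcong_trans : transitive gcong.
Proof.
move=> w v x /asboolP h1 /asboolP h2; apply/asboolP => G f Pf.
by rewrite h1 // h2.
Qed.
Canonical gcong_equiv := EquivRel gcong gcong_refl gcong_sym gcong_trans.

Definition pgroup := {eq_quot gcong}.
HB.instance Definition _ := Choice.on pgroup.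
HB.instance Definition _ := EqQuotient.on pgroup.

Definition glift (G : groupType) (f : X -> G) (a : pgroup) : G :=
  weval f (repr a).

Lemma glift_pi (G : groupType) (f : X -> G) w :
  P f -> glift f (\pi_pgroup w) = weval f w.
Proof.
move=> Pf; have /eqmodP/asboolP h : repr (\pi_pgroup w) = w %[mod pgroup].
  by rewrite reprK.
exact: h.
Qed.

Lemma pgroup_ext (a b : pgroup) :
  (forall (G : groupType) (f : X -> G), P f -> glift f a = glift f b) -> a = b.
Proof.
by move=> h; rewrite -[a]reprK -[b]reprK; apply/eqmodP/asboolP.
Qed.

Definition pgroup_one : pgroup := \pi_pgroup [::].
Definition pgroup_mul (a b : pgroup) : pgroup := \pi_pgroup (repr a ++ repr b).
Definition pgroup_inv (a : pgroup) : pgroup :=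
  \pi_pgroup (rev [seq (x.1, ~~ x.2) | x <- repr a]).
Definition pgroup_gen (x : X) : pgroup := \pi_pgroup [:: (x, false)].

Section Lift.
Variables (G : groupType) (f : X -> G).
Hypothesis Pf : P f.

Lemma weval_inv w :
  weval f (rev [seq (x.1, ~~ x.2) | x <- w]) = (weval f w)^-1%g.
Proof.
rewrite /weval; elim: w => [|[x b] w IH] /=; first by rewrite !big_nil invg1.
rewrite rev_cons -cats1 big_cat IH big_seq1 big_cons /= invgM; congr (_ * _)%g.
by case: b; rewrite ?invgK.
Qed.

Lemma glift1 : glift f pgroup_one = 1%g.
Proof. by rewrite glift_pi // /weval big_nil. Qed.
Lemma gliftM a b : glift f (pgroup_mul a b) = (glift f a * glift f b)%g.
Proof. by rewrite glift_pi // /weval big_cat. Qed.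
Lemma gliftV a : glift f (pgroup_inv a) = (glift f a)^-1%g.
Proof. by rewrite glift_pi // weval_inv. Qed.
Lemma glift_gen x : glift f (pgroup_gen x) = f x.
Proof. by rewrite glift_pi // /weval big_seq1. Qed.
End Lift.

Fact pgroup_mulA : associative pgroup_mul.
Proof.
by move=> a b c; apply: pgroup_ext => G f Pf; rewrite !gliftM // mulgA.
Qed.
Fact pgroup_mul1 : left_id pgroup_one pgroup_mul.
Proof.
by move=> a; apply: pgroup_ext => G f Pf; rewrite gliftM // glift1 // mul1g.
Qed.
Fact pgroup_mulr1 : right_id pgroup_one pgroup_mul.
Proof.
by move=> a; apply: pgroup_ext => G f Pf; rewrite gliftM // glift1 // mulg1.
Qed.
Fact pgroup_mulV : left_inverse pgroup_one pgroup_inv pgroup_mul.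
Proof.
move=> a; apply: pgroup_ext => G f Pf.
by rewrite gliftM // gliftV // glift1 // mulVg.
Qed.
Fact pgroup_mulrV : right_inverse pgroup_one pgroup_inv pgroup_mul.
Proof.
move=> a; apply: pgroup_ext => G f Pf.
by rewrite gliftM // gliftV // glift1 // mulgV.
Qed.

HB.instance Definition _ := isGroup.Build pgroup
  pgroup_mulA pgroup_mul1 pgroup_mulr1 pgroup_mulV pgroup_mulrV.

Lemma glift_monoid_morphism (G : groupType) (f : X -> G) :
  P f -> glift f 1%g = 1%g /\ {morph glift f : a b / (a * b)%g}.
Proof. by move=> Pf; split=> [|a b]; [exact: glift1|exact: gliftM]. Qed.

End PresentedGroup.

(* Unital associative algebras given by generators and relations, in the same *)
(* way.  Since [algType] requires 1 != 0, a presentation carries a            *)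
(* one-dimensional representation of its relations.                           *)

Record alg_presentation (K : fieldType) (X : Type) := AlgPresentation {
  alg_relations : forall A : algType K, (X -> A) -> Prop;
  alg_consistent : exists f : X -> K^o, alg_relations f }.

Inductive aterm (K X : Type) :=
  | TGen of X
  | TConst of K
  | TAdd of aterm K X & aterm K X
  | TMul of aterm K X & aterm K X.

HB.instance Definition _ (K X : Type) := gen_eqMixin (aterm K X).
HB.instance Definition _ (K X : Type) := gen_choiceMixin (aterm K X).

Section PresentedAlgebra.
Variables (K : fieldType) (X : Type) (P : alg_presentation K X).
Local Notation term := (aterm K X).
Local Notation rels := (alg_relations P).

Fixpoint teval (A : algType K) (f : X -> A) (s : term) : A :=
  match s with
  | TGen x => f x
  | TConst c => c%:A
  | TAdd s1 s2 => teval f s1 + teval f s2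
  | TMul s1 s2 => teval f s1 * teval f s2
  end.

Definition acong (s t : term) : bool :=
  `[< forall (A : algType K) (f : X -> A), rels f -> teval f s = teval f t >].

Lemma acong_refl : reflexive acong.
Proof. by move=> w; apply/asboolP. Qed.
Lemma acong_sym : symmetric acong.
Proof.
by move=> v w; apply/asboolP/asboolP => h G f Pf; symmetry; apply: h.
Qed.
Lemma acong_trans : transitive acong.
Proof.
move=> w v x /asboolP h1 /asboolP h2; apply/asboolP => G f Pf.
by rewrite h1 // h2.
Qed.
Canonical acong_equiv := EquivRel acong acong_refl acong_sym acong_trans.

Definition palg := {eq_quot acong}.
HB.instance Definition _ := Choice.on palg.
HB.instance Definition _ := EqQuotient.on palg.

Definition alift (A : algType K) (f : X -> A) (a : palg) : A :=
  teval f (repr a).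

Lemma alift_pi (A : algType K) (f : X -> A) s :
  rels f -> alift f (\pi_palg s) = teval f s.
Proof.
move=> Pf; have /eqmodP/asboolP h : repr (\pi_palg s) = s %[mod palg].
  by rewrite reprK.
exact: h.
Qed.

Lemma palg_ext (a b : palg) :
  (forall (A : algType K) (f : X -> A), rels f -> alift f a = alift f b) ->
  a = b.
Proof.
by move=> h; rewrite -[a]reprK -[b]reprK; apply/eqmodP/asboolP.
Qed.

Definition palg_const (c : K) : palg := \pi_palg (TConst X c).
Definition palg_add (a b : palg) : palg := \pi_palg (TAdd (repr a) (repr b)).
Definition palg_mul (a b : palg) : palg := \pi_palg (TMul (repr a) (repr b)).
Definition palg_scale (c : K) (a : palg) : palg := palg_mul (palg_const c) a.
Definition palg_opp (a : palg) : palg := palg_scale (- 1) a.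
Definition palg_gen (x : X) : palg := \pi_palg (TGen K x).

Section Lift.
Variables (A : algType K) (f : X -> A).
Hypothesis Pf : rels f.

Lemma alift_const c : alift f (palg_const c) = c%:A.
Proof. by rewrite alift_pi. Qed.
Lemma aliftD a b : alift f (palg_add a b) = alift f a + alift f b.
Proof. by rewrite alift_pi. Qed.
Lemma aliftM a b : alift f (palg_mul a b) = alift f a * alift f b.
Proof. by rewrite alift_pi. Qed.
Lemma aliftZ c a : alift f (palg_scale c a) = c *: alift f a.
Proof. by rewrite aliftM alift_const mulr_algl. Qed.
Lemma aliftN a : alift f (palg_opp a) = - alift f a.
Proof. by rewrite aliftZ scaleN1r. Qed.
Lemma alift_gen x : alift f (palg_gen x) = f x.
Proof. by rewrite alift_pi. Qed.
End Lift.

Local Ltac by_lift := 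
  let h := fresh in apply: palg_ext => ? ? h;
  rewrite ?(aliftM h, aliftD h, aliftZ h, aliftN h, alift_const h).

Fact palg_addA : associative palg_add.
Proof. by move=> a b c; by_lift; rewrite addrA. Qed.
Fact palg_addC : commutative palg_add.
Proof. by move=> a b; by_lift; rewrite addrC. Qed.
Fact palg_add0 : left_id (palg_const 0) palg_add.
Proof. by move=> a; by_lift; rewrite scale0r add0r. Qed.
Fact palg_addN : left_inverse (palg_const 0) palg_opp palg_add.
Proof. by move=> a; by_lift; rewrite scale0r addNr. Qed.
Fact palg_mulA : associative palg_mul.
Proof. by move=> a b c; by_lift; rewrite mulrA. Qed.
Fact palg_mul1 : left_id (palg_const 1) palg_mul.
Proof. by move=> a; by_lift; rewrite scale1r mul1r. Qed.
Fact palg_mulr1 : right_id (palg_const 1) palg_mul.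
Proof. by move=> a; by_lift; rewrite scale1r mulr1. Qed.
Fact palg_mulDl : left_distributive palg_mul palg_add.
Proof. by move=> a b c; by_lift; rewrite mulrDl. Qed.
Fact palg_mulDr : right_distributive palg_mul palg_add.
Proof. by move=> a b c; by_lift; rewrite mulrDr. Qed.
Fact palg_one_neq0 : palg_const 1 != palg_const 0.
Proof.
apply/eqP; have [f Pf] := alg_consistent P.
move=> /(congr1 (alift f)); rewrite !(alift_const Pf) scale0r scale1r.
by move/eqP; rewrite oner_eq0.
Qed.

HB.instance Definition _ := GRing.isNzRing.Build palg
  palg_addA palg_addC palg_add0 palg_addN palg_mulA palg_mul1 palg_mulr1
  palg_mulDl palg_mulDr palg_one_neq0.

Fact palg_scaleA c d (a : palg) :
  palg_scale c (palg_scale d a) = palg_scale (c * d) a.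
Proof. by by_lift; rewrite scalerA. Qed.
Fact palg_scale1 : left_id 1 palg_scale.
Proof. by move=> a; by_lift; rewrite scale1r. Qed.
Fact palg_scaleDr : right_distributive palg_scale +%R.
Proof. by move=> c a b; by_lift; rewrite scalerDr. Qed.
Fact palg_scaleDl (a : palg) : {morph palg_scale^~ a : c d / c + d}.
Proof. by move=> c d; by_lift; rewrite scalerDl. Qed.

HB.instance Definition _ := GRing.Zmodule_isLmodule.Build K palg
  palg_scaleA palg_scale1 palg_scaleDr palg_scaleDl.

Fact palg_scaleAl (c : K) (a b : palg) : c *: (a * b) = (c *: a) * b.
Proof.
change (palg_scale c (palg_mul a b) = palg_mul (palg_scale c a) b).
by by_lift; rewrite scalerAl.
Qed.
Fact palg_scaleAr (c : K) (a b : palg) : c *: (a * b) = a * (c *: b).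
Proof.
change (palg_scale c (palg_mul a b) = palg_mul a (palg_scale c b)).
by by_lift; rewrite scalerAr.
Qed.

HB.instance Definition _ := GRing.Lmodule_isLalgebra.Build K palg palg_scaleAl.
HB.instance Definition _ := GRing.Lalgebra_isAlgebra.Build K palg palg_scaleAr.

Lemma alift_linear (A : algType K) (f : X -> A) : rels f -> linear (alift f).
Proof. by move=> Pf c a b; rewrite (aliftD Pf) (aliftZ Pf). Qed.

Lemma alift_monoid_morphism (A : algType K) (f : X -> A) :
  rels f -> monoid_morphism (alift f).
Proof.
by move=> Pf; split=> [|a b]; rewrite ?(alift_const Pf) ?scale1r ?(aliftM Pf).
Qed.

End PresentedAlgebra.

Lemma pgroup_gen_ext (X : choiceType) (P : group_relations X) (a b : pgroup P) :
  (forall (G : groupType) (F : pgroup P -> G),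
      F 1%g = 1%g -> {morph F : x y / (x * y)%g} ->
      P G (F \o pgroup_gen P) -> F a = F b) -> a = b.
Proof.
move=> h; apply: pgroup_ext => G f Pf.
have [F1 FM] := glift_monoid_morphism Pf; apply: h => //.
have -> // : glift f \o pgroup_gen P = f.
by apply/funext => x /=; rewrite glift_gen.
Qed.

Lemma pgroup_ind (X : choiceType) (P : group_relations X)
    (Q : pgroup P -> Prop) :
  Q 1%g -> (forall x a, Q a -> Q (pgroup_gen P x * a)%g) ->
  (forall x a, Q a -> Q ((pgroup_gen P x)^-1 * a)%g) -> forall a, Q a.
Proof.
move=> Q1 Qg QV a; rewrite -[a]reprK.
elim: (repr a) => [|[x b] w IH] //.
have -> : \pi_(pgroup P) ((x, b) :: w) =
    ((if b then (pgroup_gen P x)^-1 else pgroup_gen P x) * \pi w)%g.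
  apply: pgroup_ext => G f Pf; have [_ fM] := glift_monoid_morphism Pf.
  rewrite fM !(glift_pi _ Pf) /weval big_cons; congr (_ * _)%g => /=.
  by case: b; rewrite ?(gliftV Pf) (glift_gen Pf).
by case: b; auto.
Qed.

Lemma palg_gen_ext (K : fieldType) (X : Type) (P : alg_presentation K X)
    (a b : palg P) :
  (forall (A : algType K) (F : {lrmorphism palg P -> A}),
      alg_relations P (F \o palg_gen P) -> F a = F b) -> a = b.
Proof.
move=> h; apply: palg_ext => A f Pf.
pose F : {lrmorphism palg P -> A} := HB.pack (alift f)
  (GRing.isLinear.Build K (palg P) A *:%R (alift f) (alift_linear Pf))
  (GRing.isMonoidMorphism.Build (palg P) A (alift f)
     (alift_monoid_morphism Pf)).
have FE : F \o palg_gen P = f.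
  by apply/funext => x /=; rewrite alift_gen.
by apply: (h A F); rewrite FE.
Qed.

(* The i-th generator involves the strands i and i+1. Indices start at 0.     *)

Definition strand_lo n (i : 'I_n.-1) : 'I_n := widen_ord (leq_pred n) i.

Fact strand_hi_subproof n (i : 'I_n.-1) : (i.+1 < n)%N.
Proof. by case: n i => [|n] [k]. Qed.

Definition strand_hi n (i : 'I_n.-1) : 'I_n := Ordinal (strand_hi_subproof i).

Definition widen_gen n (i : 'I_n.-1) : 'I_n.+1.-1 := widen_ord (leq_pred n) i.
Definition widen_strand n (j : 'I_n) : 'I_n.+1 := widen_ord (leqnSn n) j.
Definition last_gen n : 'I_n.+2.-1 := ord_max.
Definition last_strand n : 'I_n.+1 := ord_max.

Record braid_eqs (T : Type) (mul : T -> T -> T) n (s : 'I_n.-1 -> T) : Prop :=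
  BraidEqs {
  braid_far : forall i j : 'I_n.-1, (i.+1 < j)%N || (j.+1 < i)%N ->
    mul (s i) (s j) = mul (s j) (s i);
  braid_near : forall i j : 'I_n.-1, j = i.+1 :> nat ->
    mul (mul (s j) (s i)) (s j) = mul (mul (s i) (s j)) (s i) }.

Definition braid_relations n : group_relations 'I_n.-1 :=
  fun G s => braid_eqs ( *%g) s.

Definition braid n := pgroup (@braid_relations n).
HB.instance Definition _ n := Group.on (braid n).

Definition sigma n (i : 'I_n.-1) : braid n := pgroup_gen (@braid_relations n) i.

Lemma sigma_braid n : braid_eqs ( *%g) (@sigma n).
Proof.
by split=> [i j hij|i j hij]; apply: pgroup_gen_ext => G F F1 FM [Pf Pn];
  rewrite !FM; [exact: Pf|exact: Pn].
Qed.

Definition braid_incl n : braid n -> braid n.+1 :=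
  glift (fun i => sigma (widen_gen i)).

(* The additive group of V in multiplicative notation.                        *)
Definition addgroup (V : zmodType) : Type := V.
HB.instance Definition _ (V : zmodType) := Choice.on (addgroup V).
HB.instance Definition _ (V : zmodType) := isGroup.Build (addgroup V)
  (@addrA V) (@add0r V) (@addr0 V) (@addNr V) (@addrN V).

Definition expsum n (a : braid n) : int :=
  glift (fun _ => (1 : int) : addgroup int) a.

(* Since permutations are composed from left to right, [a t_j = t_(p j) a]    *)
(* where [p] is the inverse of the permutation [braid_perm a].                *)
Definition braid_perm n : braid n -> {perm 'I_n} :=
  glift (fun i => tperm (strand_lo i) (strand_hi i)).

Lemma tperm_braid n :
  braid_eqs ( *%g) (fun i : 'I_n.-1 => tperm (strand_lo i) (strand_hi i)).
Proof.
have lohi (i j : 'I_n.-1) : (strand_lo i == strand_lo j) = (i == j :> nat) by [].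
split=> [i j hij|i j hij].
  have E : (tperm (strand_lo i) (strand_hi i) ^
            tperm (strand_lo j) (strand_hi j))%g
         = tperm (strand_lo i) (strand_hi i).
    by rewrite tpermJ !tpermD //; apply/eqP => /(congr1 val) /=; lia.
  by rewrite -[in RHS]E conjgE tpermV !mulgA tperm2 mul1g.
have lj : strand_lo j = strand_hi i by apply: val_inj.
have E1 : (tperm (strand_lo i) (strand_hi i) ^
           tperm (strand_lo j) (strand_hi j))%g
         = tperm (strand_lo i) (strand_hi j).
  rewrite tpermJ -lj tpermL tpermD //; apply/eqP => /(congr1 val) /=; lia.
have E2 : (tperm (strand_lo j) (strand_hi j) ^
           tperm (strand_lo i) (strand_hi i))%g
         = tperm (strand_lo i) (strand_hi j).
  rewrite tpermJ lj tpermR tpermD //; apply/eqP => /(congr1 val) /=; lia.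
by move: E1; rewrite -E2 !conjgE !tpermV !mulgA.
Qed.

Lemma braid_perm1 n : braid_perm (1%g : braid n) = 1%g.
Proof. exact: (glift_monoid_morphism (tperm_braid n)).1. Qed.
Lemma braid_permM n (a b : braid n) :
  braid_perm (a * b)%g = (braid_perm a * braid_perm b)%g.
Proof. exact: (glift_monoid_morphism (tperm_braid n)).2. Qed.
Lemma braid_perm_sigma n (i : 'I_n.-1) :
  braid_perm (sigma i) = tperm (strand_lo i) (strand_hi i).
Proof. exact: (glift_gen (tperm_braid n)). Qed.

Lemma expsum_braid n :
  braid_eqs ( *%g) (fun i : 'I_n.-1 => (1 : int) : addgroup int).
Proof. by []. Qed.
Lemma addgroup1E (V : zmodType) : (1%g : addgroup V) = (0 : V).
Proof. by []. Qed.
Lemma addgroupME (V : zmodType) (x y : addgroup V) :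
  (x * y)%g = (x : V) + (y : V).
Proof. by []. Qed.
Lemma expsum1 n : expsum (1%g : braid n) = 0.
Proof. by rewrite /expsum (glift_monoid_morphism (expsum_braid n)).1. Qed.
Lemma expsumM n (a b : braid n) : expsum (a * b)%g = expsum a + expsum b.
Proof. by rewrite /expsum (glift_monoid_morphism (expsum_braid n)).2. Qed.
Lemma expsum_sigma n (i : 'I_n.-1) : expsum (sigma i) = 1.
Proof. by rewrite /expsum (glift_gen (expsum_braid n)). Qed.

Lemma braid_incl_braid n :
  braid_eqs ( *%g) (fun i : 'I_n.-1 => sigma (widen_gen i)).
Proof. by have [Hf Hn] := sigma_braid n.+1; split=> i j h; auto. Qed.
Lemma braid_incl1 n : braid_incl (1%g : braid n) = 1%g.
Proof. exact: (glift_monoid_morphism (braid_incl_braid n)).1. Qed.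
Lemma braid_inclM n (a b : braid n) :
  braid_incl (a * b)%g = (braid_incl a * braid_incl b)%g.
Proof. exact: (glift_monoid_morphism (braid_incl_braid n)).2. Qed.
Lemma braid_incl_sigma n (i : 'I_n.-1) :
  braid_incl (sigma i) = sigma (widen_gen i).
Proof. exact: (glift_gen (braid_incl_braid n)). Qed.

(* The framed braid group Z^n x| B_n: the pair (v, a) stands for the product  *)
(* of the t_k ^ (v k) followed by a.                                          *)
Definition framed (n : nat) : Type := ({ffun 'I_n -> int} * braid n)%type.
HB.instance Definition _ n := Choice.on (framed n).

Section FramedBraids.
Variable n : nat.
Implicit Types (a b : braid n) (v : {ffun 'I_n -> int}) (x y z : framed n).

Definition framed_act a v : {ffun 'I_n -> int} :=
  [ffun k => v (braid_perm a k)].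
Definition framed_one : framed n := (0, 1%g).
Definition framed_mul x y : framed n :=
  (x.1 + framed_act x.2 y.1, (x.2 * y.2)%g).
Definition framed_inv x : framed n :=
  (- framed_act (x.2)^-1%g x.1, (x.2)^-1%g).

Lemma framed_act1 v : framed_act 1%g v = v.
Proof. by apply/ffunP => k; rewrite ffunE braid_perm1 perm1. Qed.
Lemma framed_actM a b v : framed_act (a * b)%g v = framed_act a (framed_act b v).
Proof. by apply/ffunP => k; rewrite !ffunE braid_permM permM. Qed.
Lemma framed_actD a v w : framed_act a (v + w) = framed_act a v + framed_act a w.
Proof. by apply/ffunP => k; rewrite !ffunE. Qed.
Lemma framed_actN a v : framed_act a (- v) = - framed_act a v.
Proof. by apply/ffunP => k; rewrite !ffunE. Qed.

Fact framed_mulA : associative framed_mul.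
Proof.
by move=> x y z; rewrite /framed_mul /= mulgA framed_actD framed_actM addrA.
Qed.
Fact framed_mul1 : left_id framed_one framed_mul.
Proof.
by case=> v a; rewrite /framed_mul /= mul1g framed_act1 add0r.
Qed.
Fact framed_mulr1 : right_id framed_one framed_mul.
Proof.
case=> v a; rewrite /framed_mul /= mulg1; congr (_, _).
by apply/ffunP => k; rewrite !ffunE addr0.
Qed.
Fact framed_mulV : left_inverse framed_one framed_inv framed_mul.
Proof. by case=> v a; rewrite /framed_mul /= mulVg addNr. Qed.
Fact framed_mulrV : right_inverse framed_one framed_inv framed_mul.
Proof.
case=> v a; rewrite /framed_mul /= mulgV framed_actN -framed_actM mulgV.
by rewrite framed_act1 addrN.
Qed.

HB.instance Definition _ := isGroup.Build (framed n)
  framed_mulA framed_mul1 framed_mulr1 framed_mulV framed_mulrV.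

Definition framed_sigma (i : 'I_n.-1) : framed n := (0, sigma i).
Definition framed_t (j : 'I_n) : framed n := ([ffun k => (k == j)%:Z], 1%g).
Definition framed_of_braid a : framed n := (0, a).
Definition framed_expsum x : int := expsum x.2.

Lemma framed_sigma_t (i : 'I_n.-1) (j : 'I_n) :
  (framed_sigma i * framed_t j =
   framed_t (tperm (strand_lo i) (strand_hi i) j) * framed_sigma i)%g.
Proof.
congr (_, _); last by rewrite /= mulg1 mul1g.
apply/ffunP => k; rewrite !ffunE /= braid_perm_sigma add0r addr0.
by rewrite -(inj_eq (@perm_inj _ (tperm (strand_lo i) (strand_hi i)))) tpermK.
Qed.
End FramedBraids.

Definition framed_incl n (x : framed n) : framed n.+1 :=
  ([ffun k => if unlift (last_strand n) k is Some j then x.1 j else 0],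
   braid_incl x.2).

(* By the Markov theorem for framed braids, two framed braids have isotopic   *)
(* closures if and only if they are related by this equivalence.              *)
Inductive framed_markov : forall m n, framed m -> framed n -> Prop :=
  | FM_conj n (x y : framed n.+1) : framed_markov (x * y)%g (y * x)%g
  | FM_stab n (x : framed n.+1) :
      framed_markov x (framed_incl x * framed_sigma (last_gen n))%g
  | FM_stabV n (x : framed n.+1) :
      framed_markov x (framed_incl x * (framed_sigma (last_gen n))^-1)%g
  | FM_sym m n (x : framed m) (y : framed n) :
      framed_markov x y -> framed_markov y x
  | FM_trans m n p (x : framed m) (y : framed n) (z : framed p) :
      framed_markov x y -> framed_markov y z -> framed_markov x z.

(* The unit group of a ring, a unit being paired with its inverse.            *)
Section Units.
Variable A : nzRingType.
Definition inverse_pair (p : A * A) : bool :=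
  (p.1 * p.2 == 1) && (p.2 * p.1 == 1).
Definition runit : Type := {p : A * A | inverse_pair p}.
HB.instance Definition _ := Choice.on runit.

Definition runit_val (x : runit) : A := (val x).1.

Lemma runit_inj : injective runit_val.
Proof.
move=> [[a b] hx] [[a' b'] hy]; rewrite /runit_val /= => E; subst a'.
apply: val_inj; congr (_, _) => /=.
have /andP[/eqP h1 /eqP h2] := hx; have /andP[/eqP h3 /eqP h4] := hy.
move: h1 h2 h3 h4 => /= h1 h2 h3 h4.
by rewrite -[b]mulr1 -h3 mulrA h2 mul1r.
Qed.

Fact runit_oneP : inverse_pair (1, 1).
Proof. by rewrite /inverse_pair mulr1 eqxx. Qed.
Fact runit_mulP (x y : runit) :
  inverse_pair ((val x).1 * (val y).1, (val y).2 * (val x).2).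
Proof.
have /andP[/eqP h1 /eqP h2] := valP x; have /andP[/eqP h3 /eqP h4] := valP y.
apply/andP; split; apply/eqP => /=.
  by rewrite mulrA -(mulrA _ _ (val y).2) h3 mulr1 h1.
by rewrite mulrA -(mulrA _ _ (val x).1) h2 mulr1 h4.
Qed.
Fact runit_invP (x : runit) : inverse_pair ((val x).2, (val x).1).
Proof. by rewrite /inverse_pair andbC; exact: (valP x). Qed.

Definition runit_one : runit := exist inverse_pair (1, 1) runit_oneP.
Definition runit_mul (x y : runit) : runit := exist inverse_pair _ (runit_mulP x y).
Definition runit_inv (x : runit) : runit := exist inverse_pair _ (runit_invP x).

Fact runit_mulA : associative runit_mul.
Proof. by move=> x y z; apply: runit_inj; rewrite /runit_val /= mulrA. Qed.
Fact runit_mul1 : left_id runit_one runit_mul.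
Proof. by move=> x; apply: runit_inj; rewrite /runit_val /= mul1r. Qed.
Fact runit_mulr1 : right_id runit_one runit_mul.
Proof. by move=> x; apply: runit_inj; rewrite /runit_val /= mulr1. Qed.
Fact runit_mulV : left_inverse runit_one runit_inv runit_mul.
Proof.
move=> x; apply: runit_inj; rewrite /runit_val /=.
by have /andP[_ /eqP] := valP x.
Qed.
Fact runit_mulrV : right_inverse runit_one runit_inv runit_mul.
Proof.
move=> x; apply: runit_inj; rewrite /runit_val /=.
by have /andP[/eqP] := valP x.
Qed.
HB.instance Definition _ := isGroup.Build runit
  runit_mulA runit_mul1 runit_mulr1 runit_mulV runit_mulrV.

Definition mk_runit (a b : A) (h : a * b = 1) (h' : b * a = 1) : runit :=
  exist inverse_pair (a, b) (introT andP (conj (introT eqP h) (introT eqP h'))).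

Lemma runit_valM (x y : runit) :
  runit_val (x * y)%g = runit_val x * runit_val y.
Proof. by []. Qed.
End Units.

Section Algebras.
Variables (K : fieldType) (u : K).

Record hecke_eqs n (A : algType K) (h : 'I_n.-1 -> A) : Prop := HeckeEqs {
  hecke_braid : braid_eqs *%R h;
  hecke_quad : forall i, h i ^+ 2 = (u - 1) *: h i + u%:A }.

Fact hecke_consistent n : exists f : 'I_n.-1 -> K^o, hecke_eqs f.
Proof.
exists (fun _ => u); split=> // i.
by rewrite /GRing.scale /= mulr1; ring.
Qed.

Definition hecke n : algType K := palg (AlgPresentation (hecke_consistent n)).
Definition hgen n (i : 'I_n.-1) : hecke n :=
  palg_gen (AlgPresentation (hecke_consistent n)) i.

Lemma hgen_eqs n : hecke_eqs (@hgen n).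
Proof.
split; first split=> [i j hij|i j hij]; last move=> i;
  apply: palg_gen_ext => A F [[Hf Hn] Hq].
- by rewrite !rmorphM; exact: Hf.
- by rewrite !rmorphM; exact: Hn.
- by rewrite rmorphXn linearD !linearZ rmorph1; exact: Hq.
Qed.

Definition hecke_incl n : hecke n -> hecke n.+1 :=
  alift (fun i => hgen (widen_gen i)).

(* As t_j ^ d = 1, the power t_(i+1) ^ (- s) is written t_(i+1) ^ (d - s).    *)
Definition yh_e d n (A : algType K) (t : 'I_n -> A) (i : 'I_n.-1) : A :=
  d%:R^-1 *: \sum_(s < d) t (strand_lo i) ^+ s * t (strand_hi i) ^+ (d - s).

Record yh_eqs d n (A : algType K) (g : 'I_n.-1 -> A) (t : 'I_n -> A) : Prop :=
  YHEqs {
  yh_braid : braid_eqs *%R g;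
  yh_quad : forall i,
    g i ^+ 2 = 1 + (u - 1) *: yh_e d t i + (u - 1) *: (yh_e d t i * g i);
  yh_ttC : forall j k, t j * t k = t k * t j;
  yh_tX : forall j, t j ^+ d = 1;
  yh_gt_lo : forall i, g i * t (strand_lo i) = t (strand_hi i) * g i;
  yh_gt_hi : forall i, g i * t (strand_hi i) = t (strand_lo i) * g i;
  yh_gt : forall i j, j != strand_lo i -> j != strand_hi i ->
    g i * t j = t j * g i }.

Definition yh_relations d n (A : algType K) (f : 'I_n.-1 + 'I_n -> A) :=
  yh_eqs d (fun i => f (inl i)) (fun j => f (inr j)).

Fact yh_consistent d n : exists f : 'I_n.-1 + 'I_n -> K^o, yh_relations d f.
Proof.
have e1 i : yh_e d (fun _ : 'I_n => 1 : K^o) i = (d%:R != 0 :> K)%:R.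
  rewrite /yh_e (eq_bigr (fun _ => 1)) => [|s _]; last by rewrite !expr1n mulr1.
  rewrite sumr_const card_ord /GRing.scale /=.
  by case: eqP => [->|/eqP h]; rewrite ?mulr0 ?mulVf.
exists (fun x => if x is inl _ then if d%:R == 0 :> K then 1 else u else 1).
split=> //= [i|j|i|i|i j _ _]; rewrite ?expr1n ?mulr1 ?mul1r //.
rewrite e1; case: eqP => _ /=.
  by rewrite expr1n mul0r !scaler0 !addr0.
by rewrite mul1r /GRing.scale /=; ring.
Qed.

(* This is Y_(d, n)(u), with yg i = g_i and yt j = t_j.                       *)
Definition yh d n : algType K := palg (AlgPresentation (yh_consistent d n)).
Definition yg d n (i : 'I_n.-1) : yh d n :=
  palg_gen (AlgPresentation (yh_consistent d n)) (inl i).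
Definition yt d n (j : 'I_n) : yh d n :=
  palg_gen (AlgPresentation (yh_consistent d n)) (inr j).

Lemma yh_e_morph d n (A B : algType K) (F : {lrmorphism A -> B})
    (t : 'I_n -> A) i : F (yh_e d t i) = yh_e d (F \o t) i.
Proof.
rewrite /yh_e linearZ linear_sum; congr (_ *: _); apply: eq_bigr => s _.
by rewrite rmorphM !rmorphXn.
Qed.

Lemma yh_gens_eqs d n : yh_eqs d (@yg d n) (@yt d n).
Proof.
split; first split=> [i j hij|i j hij].
all: try move=> i; try move=> j; try move=> j1; try move=> j2.
all: apply: palg_gen_ext => A F [[Hf Hn] Hq Httc Htx Hlo Hhi Hgt].
- by rewrite !rmorphM; exact: Hf.
- by rewrite !rmorphM; exact: Hn.
- have FE := yh_e_morph d F (@yt d n) i; set E := yh_e _ _ _ in FE *.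
  have H : F (yg d i) ^+ 2 = 1 + (u - 1) *: F E + (u - 1) *: (F E * F (yg d i)).
    by rewrite FE; exact: Hq.
  move: E {FE} H => E H.
  by rewrite rmorphXn !linearD !linearZ rmorph1 /= rmorphM; exact: H.
- by rewrite !rmorphM; exact: Httc.
- by rewrite rmorphXn rmorph1; exact: Htx.
- by rewrite !rmorphM; exact: Hlo.
- by rewrite !rmorphM; exact: Hhi.
- by rewrite !rmorphM; exact: Hgt.
Qed.

Definition yh_incl d n : yh d n -> yh d n.+1 :=
  alift (fun x => match x with
                  | inl i => yg d (widen_gen i)
                  | inr j => yt d (widen_strand j)
                  end).

Lemma hecke_incl_eqs n : hecke_eqs (fun i : 'I_n.-1 => hgen (widen_gen i)).
Proof. by have [[Hf Hn] Hq] := hgen_eqs n.+1; do 2?split=> //; auto. Qed.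

Lemma yh_incl_eqs d n : yh_eqs d
  (fun i : 'I_n.-1 => yg d (widen_gen i)) (fun j => yt d (widen_strand j)).
Proof.
have lo (i : 'I_n.-1) : widen_strand (strand_lo i) = strand_lo (widen_gen i).
  exact: val_inj.
have hi (i : 'I_n.-1) : widen_strand (strand_hi i) = strand_hi (widen_gen i).
  exact: val_inj.
have [[Hf Hn] Hq Httc Htx Hlo Hhi Hgt] := yh_gens_eqs d n.+1.
split; first by split=> i j h; auto.
- by move=> i; rewrite Hq /yh_e lo hi.
- by move=> j k; auto.
- by move=> j; auto.
- by move=> i; rewrite lo hi.
- by move=> i; rewrite lo hi.
- by move=> i j h1 h2; apply: Hgt; rewrite -?lo -?hi.
Qed.

Lemma yh_incl_linear d n : linear (@yh_incl d n).
Proof. apply: alift_linear; exact: yh_incl_eqs. Qed.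
Lemma yh_incl_monoid_morphism d n : monoid_morphism (@yh_incl d n).
Proof. apply: alift_monoid_morphism; exact: yh_incl_eqs. Qed.

Section Inverses.
Hypothesis u_neq0 : u != 0.

Lemma hecke_mulV n (A : algType K) (h : 'I_n.-1 -> A) (i : 'I_n.-1)
    (hi := u^-1 *: (h i - (u - 1)%:A)) :
  hecke_eqs h -> h i * hi = 1 /\ hi * h i = 1.
Proof.
move=> [_ Hq]; have E : h i * h i - (u - 1) *: h i = u%:A.
  by rewrite -expr2 Hq addrC addKr.
split; rewrite /hi.
  by rewrite -scalerAr mulrBr mulr_algr E scalerA mulVf // scale1r.
by rewrite -scalerAl mulrBl mulr_algl E scalerA mulVf // scale1r.
Qed.

Section YHInverse.
Variables (d n : nat) (A : algType K) (g : 'I_n.-1 -> A) (t : 'I_n -> A).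
Hypothesis gtP : yh_eqs d g t.
Local Notation e := (yh_e d t).

Lemma yh_ge i : g i * e i = e i * g i.
Proof.
rewrite /yh_e -scalerAr -scalerAl; congr (_ *: _).
set a := t (strand_lo i); set b := t (strand_hi i).
have gaX s : g i * a ^+ s = b ^+ s * g i.
  elim: s => [|s IH]; first by rewrite !expr0 mulr1 mul1r.
  by rewrite !exprS mulrA (yh_gt_lo gtP) -mulrA IH mulrA.
have gbX s : g i * b ^+ s = a ^+ s * g i.
  elim: s => [|s IH]; first by rewrite !expr0 mulr1 mul1r.
  by rewrite !exprS mulrA (yh_gt_hi gtP) -mulrA IH mulrA.
have -> : g i * (\sum_(s < d) a ^+ s * b ^+ (d - s)) =
    (\sum_(s < d) b ^+ s * a ^+ (d - s)) * g i.
  rewrite mulr_sumr mulr_suml; apply: eq_bigr => s _.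
  by rewrite mulrA gaX -mulrA gbX mulrA.
congr (_ * _); apply: (addIr 1).
have ad : a ^+ d = 1 by exact: yh_tX gtP _.
have bd : b ^+ d = 1 by exact: yh_tX gtP _.
have -> : \sum_(s < d) b ^+ s * a ^+ (d - s) + 1 =
    \sum_(s < d.+1) b ^+ s * a ^+ (d - s).
  by rewrite big_ord_recr /= subnn mulr1 bd.
have -> : \sum_(s < d) a ^+ s * b ^+ (d - s) + 1 =
    \sum_(s < d.+1) a ^+ s * b ^+ (d - s).
  by rewrite big_ord_recr /= subnn mulr1 ad.
rewrite (reindex_inj rev_ord_inj) /=; apply: eq_bigr => s _.
have sd : (s <= d)%N by rewrite -ltnS.
rewrite subSS subKn //.
have ab : GRing.comm a b by exact: yh_ttC gtP _ _.
by apply/commrX/commr_sym/commrX.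
Qed.

Lemma yh_ee i : e i * e i = e i.
Proof.
have [d0|d_neq0] := eqVneq (d%:R : K) 0.
  by rewrite /yh_e d0 invr0 !scale0r mulr0.
set a := t (strand_lo i); set b := t (strand_hi i).
have ad : a ^+ d = 1 by exact: yh_tX gtP _.
have bd : b ^+ d = 1 by exact: yh_tX gtP _.
have ab : GRing.comm a b by exact: yh_ttC gtP _ _.
have d0 : (0 < d)%N by case: d d_neq0; rewrite ?eqxx.
pose w := a * b ^+ d.-1.
have wX s : (s <= d)%N -> w ^+ s = a ^+ s * b ^+ (d - s).
  move=> sd; rewrite exprMn_comm; last exact: commrX.
  congr (_ * _); rewrite -exprM.
  case: s sd => [|s] sd; first by rewrite muln0 subn0 bd.
  have -> : (d.-1 * s.+1 = d * s + (d - s.+1))%N by nia.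
  by rewrite exprD exprM bd expr1n mul1r.
have eE : e i = d%:R^-1 *: \sum_(s < d) w ^+ s.
  by congr (_ *: _); apply: eq_bigr => s _; rewrite wX // ltnW.
have we : w * e i = e i.
  rewrite eE -scalerAr; congr (_ *: _); rewrite mulr_sumr.
  under eq_bigr do rewrite -exprS.
  apply: (addIr 1); have wd : w ^+ d = 1 by rewrite wX // subnn ad mulr1.
  rewrite -{2}wd -(big_ord_recr d (fun s => w ^+ s)) big_ord_recl /= expr0.
  by rewrite addrC.
have wXe s : w ^+ s * e i = e i.
  by elim: s => [|s IH]; rewrite ?expr0 ?mul1r // exprS -mulrA IH.
rewrite {1}eE -scalerAl mulr_suml; under eq_bigr do rewrite wXe.
by rewrite sumr_const card_ord -scaler_nat scalerA mulVf // scale1r.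
Qed.

Lemma yh_mulV i (gi := g i + (u^-1 - 1) *: e i + (u^-1 - 1) *: (e i * g i)) :
  g i * gi = 1 /\ gi * g i = 1.
Proof.
rewrite {}/gi; have ge := yh_ge i; have ee := yh_ee i.
have q := yh_quad gtP i; move: (e i) (g i) ge ee q => E G ge ee q.
set gi := G + _ + _; have comm : G * gi = gi * G.
  by rewrite /gi !mulrDr !mulrDl -!scalerAr -!scalerAl mulrA ge -!mulrA.
suff h : gi * G = 1 by rewrite comm.
have egg : E * G * G = u *: E + (u - 1) *: (E * G).
  rewrite -mulrA -expr2 q !mulrDr mulr1 -!scalerAr !mulrA ee.
  by rewrite -{1}[E]scale1r -scalerDl [1 + _]addrC subrK.
rewrite /gi !mulrDl -expr2 -!scalerAl egg q scalerDr !scalerA.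
rewrite !addrA [LHS](ACl (1 * ((2 * 5) * ((3 * 4) * 6)))) /= -!scalerDl.
have -> : u - 1 + (u^-1 - 1) * u = 0 by field.
have -> : u - 1 + (u^-1 - 1) + (u^-1 - 1) * (u - 1) = 0 by field.
by rewrite !scale0r !addr0.
Qed.
End YHInverse.
End Inverses.
End Algebras.

Section Representations.
Variables (K : fieldType) (u : K).
Hypothesis u_neq0 : u != 0.

Section Maps.
Variables (d n : nat).

Definition hecke_unit (i : 'I_n.-1) : runit (hecke u n) :=
  let h := hecke_mulV u_neq0 i (hgen_eqs u n) in mk_runit h.1 h.2.
Definition yh_unit (i : 'I_n.-1) : runit (yh u d n) :=
  let h := yh_mulV u_neq0 (yh_gens_eqs u d n) i in mk_runit h.1 h.2.

Lemma hecke_unit_braid : braid_eqs ( *%g) hecke_unit.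
Proof.
have [[Hf Hn] _] := hgen_eqs u n.
by split=> i j h; apply: runit_inj; [exact: Hf|exact: Hn].
Qed.
Lemma yh_unit_braid : braid_eqs ( *%g) yh_unit.
Proof.
have [[Hf Hn] _ _ _ _ _ _] := yh_gens_eqs u d n.
by split=> i j h; apply: runit_inj; [exact: Hf|exact: Hn].
Qed.

(* The restrictions to B_n and F_n of the natural maps from the group         *)
(* algebras.                                                                  *)
Definition hecke_rep (a : braid n) : hecke u n := runit_val (glift hecke_unit a).
Definition yh_rep (a : braid n) : yh u d n := runit_val (glift yh_unit a).

(* As t_j ^ d = 1, only the framings modulo d matter.                         *)
Definition yh_framing (v : {ffun 'I_n -> int}) : yh u d n :=
  \prod_(j < n) yt u d j ^+ `|(v j %% d)%Z|.
Definition framed_rep (x : framed n) : yh u d n :=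
  yh_framing x.1 * yh_rep x.2.

Lemma hecke_rep1 : hecke_rep 1%g = 1.
Proof. by rewrite /hecke_rep (glift_monoid_morphism hecke_unit_braid).1. Qed.
Lemma hecke_repM a b : hecke_rep (a * b)%g = hecke_rep a * hecke_rep b.
Proof.
rewrite /hecke_rep (glift_monoid_morphism hecke_unit_braid).2; exact: runit_valM.
Qed.
Lemma hecke_rep_sigma i : hecke_rep (sigma i) = hgen u i.
Proof. by rewrite /hecke_rep (glift_gen hecke_unit_braid). Qed.

Lemma yh_rep1 : yh_rep 1%g = 1.
Proof. by rewrite /yh_rep (glift_monoid_morphism yh_unit_braid).1. Qed.
Lemma yh_repM a b : yh_rep (a * b)%g = yh_rep a * yh_rep b.
Proof.
rewrite /yh_rep (glift_monoid_morphism yh_unit_braid).2; exact: runit_valM.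
Qed.
Lemma yh_rep_sigma i : yh_rep (sigma i) = yg u d i.
Proof. by rewrite /yh_rep (glift_gen yh_unit_braid). Qed.

Local Notation t := (yt u d).

Lemma yt_comm (j k : 'I_n) r s : GRing.comm (t j ^+ r) (t k ^+ s).
Proof.
apply/commrX/commr_sym/commrX; exact: yh_ttC (yh_gens_eqs u d n) _ _.
Qed.

Lemma yh_framing0 : yh_framing 0 = 1.
Proof. by rewrite /yh_framing big1 // => j _; rewrite ffunE mod0z expr0. Qed.

Lemma framed_rep1 : framed_rep 1%g = 1.
Proof. by rewrite /framed_rep /= yh_framing0 yh_rep1 mulr1. Qed.

Lemma framed_rep_braid a : framed_rep (framed_of_braid a) = yh_rep a.
Proof. by rewrite /framed_rep /= yh_framing0 mul1r. Qed.

Lemma framed_rep_sigma i : framed_rep (framed_sigma i) = yg u d i.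
Proof. by rewrite framed_rep_braid yh_rep_sigma. Qed.

Hypothesis d_gt0 : (0 < d)%N.

Lemma yt_modn (j : 'I_n) r : t j ^+ (r %% d) = t j ^+ r.
Proof.
rewrite [in RHS](divn_eq r d) exprD mulnC exprM.
by rewrite (yh_tX (yh_gens_eqs u d n)) expr1n mul1r.
Qed.

Lemma yt_modz (j : 'I_n) (m m' : int) :
  t j ^+ `|((m + m') %% d)%Z| = t j ^+ `|(m %% d)%Z| * t j ^+ `|(m' %% d)%Z|.
Proof.
rewrite -exprD -[RHS]yt_modn; congr (_ ^+ _).
have d0 : d%:Z != 0 by lia.
by apply/eqP; rewrite -eqz_nat -modz_nat PoszD !gez0_abs ?modz_ge0 // modzDm.
Qed.

Lemma yh_framingD v w : yh_framing (v + w) = yh_framing v * yh_framing w.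
Proof.
rewrite /yh_framing.
pose C (x : yh u d n) := forall k r, GRing.comm x (t k ^+ r).
suff [] : \prod_(j < n) t j ^+ `|((v + w)%R j %% d)%Z| =
    (\prod_(j < n) t j ^+ `|(v j %% d)%Z|) *
    (\prod_(j < n) t j ^+ `|(w j %% d)%Z|) /\
    C (\prod_(j < n) t j ^+ `|(v j %% d)%Z|) by [].
elim/big_rec3: _ => [|j x y z _ [-> Cy]].
  by rewrite mulr1; split=> // k r; exact: commr_sym (commr1 _).
split; last by move=> k r; apply/commr_sym/commrM; 
  [exact: yt_comm|exact/commr_sym/Cy].
by rewrite ffunE yt_modz !mulrA; congr (_ * _); rewrite -!mulrA Cy.
Qed.

Lemma framed_rep_t j : framed_rep (framed_t j) = t j.
Proof.
rewrite /framed_rep /= yh_rep1 mulr1 /yh_framing.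
rewrite (big_only1 j) //= => [|k kj _]; rewrite ffunE ?eqxx ?(negPf kj).
  by rewrite modz_nat absz_nat yt_modn expr1.
by rewrite mod0z expr0.
Qed.

Lemma yh_framing_single (j : 'I_n) (m : int) :
  yh_framing [ffun k => if k == j then m else 0] = t j ^+ `|(m %% d)%Z|.
Proof.
rewrite /yh_framing (big_only1 j) //= => [|k kj _].
  by rewrite ffunE eqxx.
by rewrite ffunE (negPf kj) mod0z expr0.
Qed.

Lemma yh_framing_sigma (i : 'I_n.-1) v :
  yg u d i * yh_framing v = yh_framing (framed_act (sigma i) v) * yg u d i.
Proof.
have [_ _ _ _ Hlo Hhi Hgt] := yh_gens_eqs u d n.
have gt j : yg u d i * t j = t (tperm (strand_lo i) (strand_hi i) j) * yg u d i.
  by case: tpermP => [->|->|/eqP h1 /eqP h2]; auto.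
have gtX j r :
    yg u d i * t j ^+ r = t (tperm (strand_lo i) (strand_hi i) j) ^+ r * yg u d i.
  elim: r => [|r IH]; first by rewrite !expr0 mul1r mulr1.
  by rewrite !exprS mulrA gt -mulrA IH mulrA.
have -> : v = \sum_j [ffun k => if k == j then v j else 0].
  apply/ffunP => k; rewrite sum_ffunE (big_only1 k) //= => [|j jk _].
    by rewrite ffunE eqxx.
  by rewrite ffunE eq_sym (negPf jk).
elim/big_rec: _ => [|j w _ IH].
  have -> : framed_act (sigma i) 0 = 0 by apply/ffunP => k; rewrite !ffunE.
  by rewrite yh_framing0 mul1r mulr1.
rewrite framed_actD !yh_framingD mulrA yh_framing_single gtX -mulrA IH mulrA.
congr (_ * _ * _).
rewrite -yh_framing_single; congr yh_framing.
apply/ffunP => k; rewrite !ffunE braid_perm_sigma.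
by rewrite -(inj_eq (@perm_inj _ (tperm (strand_lo i) (strand_hi i)))) tpermK.
Qed.

Lemma yh_framing_act (a : braid n) v :
  yh_rep a * yh_framing v = yh_framing (framed_act a v) * yh_rep a.
Proof.
elim/pgroup_ind: a v => [v|i a IH v|i a IH v].
- by rewrite yh_rep1 framed_act1 mul1r mulr1.
- rewrite yh_repM framed_actM -mulrA IH mulrA yh_rep_sigma yh_framing_sigma.
  by rewrite mulrA.
- have sV : yh_rep (sigma i)^-1%g * yg u d i = 1.
    by rewrite -yh_rep_sigma -yh_repM mulVg yh_rep1.
  have Vs : yg u d i * yh_rep (sigma i)^-1%g = 1.
    by rewrite -yh_rep_sigma -yh_repM mulgV yh_rep1.
  rewrite yh_repM framed_actM -mulrA IH !mulrA; congr (_ * _).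
  set w := framed_act a v; set w' := framed_act _ w.
  have -> : w = framed_act (sigma i) w' by rewrite -framed_actM mulgV framed_act1.
  rewrite -[LHS]mulr1 -Vs mulrA -(mulrA _ (yh_framing _)) -yh_framing_sigma.
  by rewrite mulrA sV mul1r.
Qed.

Lemma framed_repM x y : framed_rep (x * y)%g = framed_rep x * framed_rep y.
Proof.
rewrite /framed_rep /= yh_framingD yh_repM.
by rewrite -mulrA [X in _ * X]mulrA -yh_framing_act !mulrA.
Qed.
End Maps.
End Representations.

Definition ratfunc (R : realType) : fieldType := {fraction {poly R[i]}}.
Definition indet (R : realType) : ratfunc R := tofrac 'X.
Definition ratconst (R : realType) (c : R[i]) : ratfunc R := tofrac c%:P.

Lemma indet_neq0 (R : realType) : indet R != 0.
Proof. by rewrite /indet tofrac_eq0 polyX_eq0. Qed.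

(* The traces are families of maps compatible with the inclusions, the value  *)
(* at n = 0 being irrelevant.                                                 *)
Record ocneanu_trace (K : fieldType) (u zeta : K)
    (tau : forall n, hecke u n -> K) : Prop := OcneanuTrace {
  ocneanu_linear : forall n c (a b : hecke u n.+1),
    tau n.+1 (c *: a + b) = c * tau n.+1 a + tau n.+1 b;
  ocneanu_incl : forall n (a : hecke u n.+1),
    tau n.+2 (hecke_incl a) = tau n.+1 a;
  ocneanu_comm : forall n (a b : hecke u n.+1),
    tau n.+1 (a * b) = tau n.+1 (b * a);
  ocneanu_one : forall n, tau n.+1 1 = 1;
  ocneanu_gen : forall n (a : hecke u n.+1),
    tau n.+2 (hecke_incl a * hgen u (last_gen n)) = zeta * tau n.+1 a }.

Record markov_trace (K : fieldType) (u : K) (d : nat) (z : K) (x : nat -> K)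
    (tr : forall n, yh u d n -> K) : Prop := MarkovTrace {
  markov_linear : forall n c (a b : yh u d n.+1),
    tr n.+1 (c *: a + b) = c * tr n.+1 a + tr n.+1 b;
  markov_incl : forall n (a : yh u d n.+1), tr n.+2 (yh_incl a) = tr n.+1 a;
  markov_comm : forall n (a b : yh u d n.+1),
    tr n.+1 (a * b) = tr n.+1 (b * a);
  markov_one : forall n, tr n.+1 1 = 1;
  markov_gen : forall n (a : yh u d n.+1),
    tr n.+2 (yh_incl a * yg u d (last_gen n)) = z * tr n.+1 a;
  markov_framing : forall n s (a : yh u d n.+1), (0 < s < d)%N ->
    tr n.+2 (yh_incl a * yt u d (last_strand n.+1) ^+ s) = x s * tr n.+1 a }.

Section Invariants.
Variables (R : realType) (L : fieldType) (iota : {rmorphism ratfunc R -> L}).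
Variable sqrtu : L.
Local Notation u := (indet R).

Definition link_factor (n : nat) (e : int) : L :=
  (- ((1 + iota u) / sqrtu)) ^+ n.-1 * sqrtu ^ e.

Definition jones (tau : forall n, hecke u n -> ratfunc R) n (a : braid n) : L :=
  link_factor n (expsum a) * iota (tau n (hecke_rep (indet_neq0 R) a)).

Definition yh_invariant d (tr : forall n, yh u d n -> ratfunc R) n
    (a : braid n) : L :=
  link_factor n (expsum a) * iota (tr n (yh_rep (indet_neq0 R) d a)).

Definition framed_yh_invariant d (tr : forall n, yh u d n -> ratfunc R) n
    (x : framed n) : L :=
  link_factor n (framed_expsum x) *
    iota (tr n (framed_rep (indet_neq0 R) d x)).
End Invariants.

(* Main.v *)
Require Import Defs.
From HB Require Import structures.
From mathcomp Require Import all_boot all_order all_algebra perm.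
From mathcomp Require Import boolp reals.
From mathcomp Require Import complex ring zify.

Import GRing.Theory.
Local Open Scope ring_scope.

(** Put [w = x_1], or [w = 1] when [d = 1].  Sending [g_i] to [h_i] and every
    framing generator [t_j] to the scalar [w] respects the defining relations:
    each [t_i^s t_(i+1)^(-s)] becomes [1], so the idempotent [e_i] becomes [1]
    and the quadratic relation of the Yokonuma-Hecke algebra turns into that of
    the Iwahori-Hecke algebra.  This gives compatible algebra maps [phi] from
    [Y_(d,n)(u)] to [H_n(u)] ([specialization]).

    Composing the Ocneanu trace with [phi] yields a Markov trace whose framing
    parameters are the powers [w^s], that is, the [x_s] ([specialized_trace]).
    A Markov trace is determined by its parameters ([markov_trace_unique]),
    because [Y_(d,n+1)] is spanned by the elements [a g_n b] and [a t_(n+1)^s]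
    with [a], [b] in [Y_(d,n)] ([last_spanP]).  Hence [tr = tau o phi].

    On a framed braid [phi] gives the Hecke image of the underlying braid times
    [w] to the sum of the framings, so the framed invariant is the Jones
    polynomial of the underlying link times that power of [w]
    ([framed_invariantE]).  All the claims then reduce to the trace property,
    the stabilization invariance and the skein relation of the Jones polynomial,
    the total framing being unchanged by Markov moves. *)

(** * Algebras given by generators and relations *)

Section PresentedAlgebraInduction.
Local Open Scope quotient_scope.
Context {K : fieldType} {X : Type} {P : alg_presentation K X}.

(** Left multiplication by generators, together with linear combinations,
    reaches every element from [1]: a term is an operator acting on the left of
    the elements already reached. *)
Lemma palg_ind (Q : palg P -> Prop) :
  Q 1 -> (forall a b, Q a -> Q b -> Q (a + b)) ->
  (forall c a, Q a -> Q (c *: a)) ->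
  (forall x a, Q a -> Q (palg_gen P x * a)) -> forall a, Q a.
Proof.
move=> Q1 QD QZ Qg a; rewrite -[a]reprK -[X in Q X]mulr1.
elim: (repr a) (1 : palg P) Q1 => [x|c|s IHs t IHt|s IHs t IHt] b Qb.
- exact: Qg.
- suff -> : \pi_(palg P) (TConst X c) * b = c *: b by exact: QZ.
  by [].
- have -> : \pi_(palg P) (TAdd s t) = \pi_(palg P) s + \pi_(palg P) t.
    apply: palg_ext => A f Pf.
    by rewrite (aliftD Pf) !(alift_pi _ Pf).
  by rewrite mulrDl; apply: QD; [exact: IHs|exact: IHt].
- have -> : \pi_(palg P) (TMul s t) = \pi_(palg P) s * \pi_(palg P) t.
    apply: palg_ext => A f Pf.
    by rewrite (aliftM Pf) !(alift_pi _ Pf).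
  by rewrite -mulrA; apply: IHs; exact: IHt.
Qed.

Lemma palg_lrmorphism_ext (A : algType K) (F G : {lrmorphism palg P -> A}) :
  (forall x, F (palg_gen P x) = G (palg_gen P x)) -> F =1 G.
Proof.
move=> FG; elim/palg_ind=> [|a b Fa Fb|c a Fa|x a Fa].
- by rewrite !rmorph1.
- by rewrite !rmorphD /= Fa Fb.
- by rewrite !linearZ /= Fa.
- by rewrite !rmorphM /= FG Fa.
Qed.

Lemma palg_commute (A : algType K) (F : {lrmorphism palg P -> A}) (y : A) :
  (forall x, F (palg_gen P x) * y = y * F (palg_gen P x)) ->
  forall a, F a * y = y * F a.
Proof.
move=> Fy; elim/palg_ind=> [|a b Fa Fb|c a Fa|x a Fa].
- by rewrite rmorph1 mul1r mulr1.
- by rewrite rmorphD /= mulrDl mulrDr Fa Fb.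
- by rewrite linearZ /= -scalerAl -scalerAr Fa.
- by rewrite rmorphM /= -mulrA Fa !mulrA Fy.
Qed.

Section Lift.
Context {A : algType K} {f : X -> A} (Pf : alg_relations P f).

Definition palg_lift : {lrmorphism palg P -> A} :=
  HB.pack (alift f)
    (GRing.isLinear.Build K (palg P) A *:%R (alift f) (alift_linear Pf))
    (GRing.isMonoidMorphism.Build (palg P) A (alift f)
       (alift_monoid_morphism Pf)).

Lemma palg_lift_gen x : palg_lift (palg_gen P x) = f x.
Proof. exact: (alift_gen Pf). Qed.
End Lift.
End PresentedAlgebraInduction.

Lemma yh_ind (K : fieldType) (u : K) (d n : nat) (Q : yh u d n -> Prop) :
  Q 1 -> (forall a b, Q a -> Q b -> Q (a + b)) ->
  (forall c a, Q a -> Q (c *: a)) ->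
  (forall i a, Q a -> Q (yg u d i * a)) ->
  (forall j a, Q a -> Q (yt u d j * a)) -> forall a, Q a.
Proof.
move=> Q1 QD QZ Qg Qt.
by apply: (palg_ind (P := AlgPresentation (yh_consistent u d n))) => // -[].
Qed.

(** * The towers of algebras *)

Section Inclusions.
Context {K : fieldType} (u : K) (d n : nat).

HB.instance Definition _ := GRing.isLinear.Build K (yh u d n) (yh u d n.+1) *:%R
  (@yh_incl K u d n) (@yh_incl_linear K u d n).
HB.instance Definition _ := GRing.isMonoidMorphism.Build
  (yh u d n) (yh u d n.+1) (@yh_incl K u d n) (@yh_incl_monoid_morphism K u d n).

HB.instance Definition _ := GRing.isLinear.Build K (hecke u n) (hecke u n.+1) *:%R
  (@hecke_incl K u n) (alift_linear (P := AlgPresentation (hecke_consistent u n))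
     (hecke_incl_eqs u n)).
HB.instance Definition _ := GRing.isMonoidMorphism.Build
  (hecke u n) (hecke u n.+1) (@hecke_incl K u n)
  (alift_monoid_morphism (P := AlgPresentation (hecke_consistent u n))
     (hecke_incl_eqs u n)).

Lemma yh_incl_g (i : 'I_n.-1) : yh_incl (yg u d i) = yg u d (widen_gen i).
Proof.
exact: (alift_gen (P := AlgPresentation (yh_consistent u d n))
          (yh_incl_eqs u d n) (inl i)).
Qed.
Lemma yh_incl_t (j : 'I_n) : yh_incl (yt u d j) = yt u d (widen_strand j).
Proof.
exact: (alift_gen (P := AlgPresentation (yh_consistent u d n))
          (yh_incl_eqs u d n) (inr j)).
Qed.
Lemma hecke_incl_h (i : 'I_n.-1) : hecke_incl (hgen u i) = hgen u (widen_gen i).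
Proof.
exact: (alift_gen (P := AlgPresentation (hecke_consistent u n))
          (hecke_incl_eqs u n) i).
Qed.
End Inclusions.

(** * A spanning set of the Yokonuma-Hecke algebra *)

Section Spanning.
Context {K : fieldType} {u : K} {d : nat}.

Local Notation incl := (@yh_incl K u d _).
Local Notation G n := (yg u d (last_gen n)).
Local Notation T n := (yt u d (last_strand n)).

(** Scalars are absorbed into [a], and [a] itself is the case [s = 0] of the last
    constructor, so closure under addition suffices for a subspace. *)
Inductive last_span n : yh u d n.+2 -> Prop :=
  | LastSpanD a b : last_span n a -> last_span n b -> last_span n (a + b)
  | LastSpanG (a b : yh u d n.+1) : last_span n (incl a * G n * incl b)
  | LastSpanT (a : yh u d n.+1) s : last_span n (incl a * T n.+1 ^+ s).

Lemma last_gen_quad n : G n ^+ 2 =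
  1 + (u - 1) *: yh_e d (@yt _ u d n.+2) (last_gen n)
  + (u - 1) *: (yh_e d (@yt _ u d n.+2) (last_gen n) * G n).
Proof. exact: (yh_quad (yh_gens_eqs u d n.+2) (last_gen n)). Qed.

Lemma strand_lo_last_gen n : strand_lo (last_gen n) = widen_strand (last_strand n).
Proof. exact: val_inj. Qed.
Lemma strand_hi_last_gen n : strand_hi (last_gen n) = last_strand n.+1.
Proof. exact: val_inj. Qed.

Lemma last_gen_e n : yh_e d (@yt _ u d n.+2) (last_gen n) =
  d%:R^-1 *: \sum_(s < d) incl (T n ^+ s) * T n.+1 ^+ (d - s).
Proof.
rewrite /yh_e strand_lo_last_gen strand_hi_last_gen; congr (_ *: _).
by apply: eq_bigr => s _; rewrite rmorphXn /= yh_incl_t.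
Qed.

Lemma last_gen_inclT n s : G n * incl (T n ^+ s) = T n.+1 ^+ s * G n.
Proof.
elim: s => [|s IH]; first by rewrite !expr0 rmorph1 mulr1 mul1r.
rewrite exprS rmorphM /= mulrA yh_incl_t -strand_lo_last_gen.
by rewrite (yh_gt_lo (yh_gens_eqs u d n.+2)) strand_hi_last_gen exprS -!mulrA IH.
Qed.

Lemma last_gen_T n s : G n * T n.+1 ^+ s = incl (T n ^+ s) * G n.
Proof.
elim: s => [|s IH]; first by rewrite !expr0 rmorph1 mulr1 mul1r.
rewrite !exprS rmorphM /= yh_incl_t -strand_hi_last_gen mulrA.
by rewrite (yh_gt_hi (yh_gens_eqs u d n.+2)) strand_lo_last_gen strand_hi_last_gen
  -!mulrA IH.
Qed.

Lemma incl_commT n (a : yh u d n.+1) : incl a * T n.+1 = T n.+1 * incl a.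
Proof.
apply: palg_commute a => -[i|j].
  change (incl (yg u d i) * T n.+1 = T n.+1 * incl (yg u d i)).
  rewrite yh_incl_g.
  apply: (yh_gt (yh_gens_eqs u d n.+2)); apply/eqP => /(congr1 val) /=;
    case: i => i /=; lia.
change (incl (yt u d j) * T n.+1 = T n.+1 * incl (yt u d j)).
rewrite yh_incl_t.
exact: (yh_ttC (yh_gens_eqs u d n.+2)).
Qed.

Lemma incl_commTX n (a : yh u d n.+1) s :
  incl a * T n.+1 ^+ s = T n.+1 ^+ s * incl a.
Proof. by apply: commrX; exact: incl_commT. Qed.

Lemma incl_incl_commG n (a : yh u d n.+1) :
  incl (incl a) * G n.+1 = G n.+1 * incl (incl a).
Proof.
pose F : {lrmorphism yh u d n.+1 -> yh u d n.+3} :=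
  @yh_incl _ u d n.+2 \o @yh_incl _ u d n.+1.
apply: (palg_commute _ F _ _ a) => -[i|j].
  change (incl (incl (yg u d i)) * G n.+1 = G n.+1 * incl (incl (yg u d i))).
  rewrite !yh_incl_g.
  apply: (braid_far (yh_braid (yh_gens_eqs u d n.+3))).
  by case: i => i /=; lia.
change (incl (incl (yt u d j)) * G n.+1 = G n.+1 * incl (incl (yt u d j))).
rewrite !yh_incl_t.
symmetry; apply: (yh_gt (yh_gens_eqs u d n.+3)); apply/eqP => /(congr1 val) /=;
    case: j => j /=; lia.
Qed.

Lemma last_gen_braid n :
  G n.+1 * incl (G n) * G n.+1 = incl (G n) * G n.+1 * incl (G n).
Proof.
rewrite yh_incl_g.
exact: (braid_near (yh_braid (yh_gens_eqs u d n.+3))).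
Qed.

Lemma last_span_incl n a : last_span n (incl a).
Proof. by have := LastSpanT n a 0; rewrite expr0 mulr1. Qed.

Lemma last_spanM n a b x : last_span n x -> last_span n (incl a * x * incl b).
Proof.
elim=> [x1 x2 _ IH1 _ IH2|a1 b1|a1 s].
- by rewrite mulrDr mulrDl; exact: LastSpanD.
- have -> : incl a * (incl a1 * G n * incl b1) * incl b =
     incl (a * a1) * G n * incl (b1 * b) by rewrite !rmorphM /= !mulrA.
  exact: LastSpanG.
- rewrite mulrA -mulrA -incl_commTX mulrA -!rmorphM; exact: LastSpanT.
Qed.

Lemma last_spanZ n c x : last_span n x -> last_span n (c *: x).
Proof.
move=> /(last_spanM n c%:A 1).
by rewrite rmorph1 mulr1 linearZ /= rmorph1 mulr_algl.
Qed.

Lemma last_spanT n x : last_span n x -> last_span n (T n.+1 * x).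
Proof.
elim=> [x1 x2 _ IH1 _ IH2|a b|a s].
- by rewrite mulrDr; exact: LastSpanD.
- rewrite !mulrA -incl_commT -[_ * _ * G n]mulrA.
  have := last_gen_inclT n 1; rewrite !expr1 => <-.
  by rewrite mulrA -mulrA -rmorphM; exact: LastSpanG.
- by rewrite mulrA -incl_commT -mulrA -exprS; exact: LastSpanT.
Qed.

Lemma last_spanTX n s x : last_span n x -> last_span n (T n.+1 ^+ s * x).
Proof.
move=> Sx; elim: s => [|s IH]; rewrite ?mul1r // exprS -mulrA.
exact: last_spanT.
Qed.

Lemma last_span_sum n r (F : 'I_r -> yh u d n.+2) :
  (forall i, last_span n (F i)) -> last_span n (\sum_i F i).
Proof.
move=> SF; apply: (big_ind (last_span n)) => //; last exact: LastSpanD.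
by rewrite -(rmorph0 incl); exact: last_span_incl.
Qed.

(** The quadratic relation gives this at once, as [e_n g_n] is a combination of
    the [t_n^s g_n t_n^(d-s)]. *)
Lemma last_span_quad n : last_span n (G n ^+ 2).
Proof.
rewrite last_gen_quad last_gen_e.
apply: LastSpanD; first apply: LastSpanD.
- by rewrite -(rmorph1 incl); exact: last_span_incl.
- do 2! apply: last_spanZ; apply: last_span_sum => s; exact: LastSpanT.
- rewrite -scalerAl mulr_suml; do 2! apply: last_spanZ.
  apply: last_span_sum => s; rewrite -mulrA -last_gen_inclT mulrA; exact: LastSpanG.
Qed.

(** Two occurrences of the last generator are brought together: [c] commutes with
    it, and it moves past the framing [t_n^s], which becomes [t_(n+1)^s]. *)
Lemma last_span_quad_framing n (c : yh u d n.+1) s b :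
  incl c * G n = G n * incl c ->
  last_span n (G n * incl (c * T n ^+ s) * G n * incl b).
Proof.
move=> cG; have -> : G n * incl (c * T n ^+ s) * G n * incl b =
    incl c * (T n.+1 ^+ s * G n ^+ 2) * incl b.
  by rewrite rmorphM /= mulrA -cG -(mulrA (incl c)) last_gen_inclT expr2 !mulrA.
by apply: last_spanM; apply: last_spanTX; exact: last_span_quad.
Qed.

(** The span contains [1] and is stable under left multiplication by every
    generator; only [g_n], applied to [a g_n b], needs more than the relations
    between [g_n], [t_n] and [t_(n+1)]. *)
Lemma last_span_of_sandwich n :
  (forall a b, last_span n (G n * incl a * G n * incl b)) ->
  forall x, last_span n x.
Proof.
move=> GaG; elim/yh_ind=> [|x y Sx Sy|c x Sx|i x Sx|j x Sx].
- by rewrite -(rmorph1 incl); exact: last_span_incl.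
- exact: LastSpanD.
- exact: last_spanZ.
- have [lt_in|ge_in] := ltnP i n.
    pose i' : 'I_n.+1.-1 := Ordinal lt_in.
    have -> : yg u d i = incl (yg u d i').
      by rewrite yh_incl_g; congr (yg u d _); exact: val_inj.
    by have := last_spanM n (yg u d i') 1 x Sx; rewrite rmorph1 mulr1.
  have -> : i = last_gen n by apply: val_inj => /=; case: i ge_in => i /=; lia.
  elim: Sx => [x1 x2 _ IH1 _ IH2|a b|a s].
  + by rewrite mulrDr; exact: LastSpanD.
  + by rewrite !mulrA; exact: GaG.
  + rewrite incl_commTX mulrA last_gen_T; exact: LastSpanG.
- have [lt_jn|ge_jn] := ltnP j n.+1.
    pose j' : 'I_n.+1 := Ordinal lt_jn.
    have -> : yt u d j = incl (yt u d j').
      by rewrite yh_incl_t; congr (yt u d _); exact: val_inj.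
    by have := last_spanM n (yt u d j') 1 x Sx; rewrite rmorph1 mulr1.
  have -> : j = last_strand n.+1.
    by apply: val_inj => /=; case: j ge_jn => j /=; lia.
  exact: last_spanT.
Qed.

Lemma yh1_ind (Q : yh u d 1 -> Prop) :
  (forall a b, Q a -> Q b -> Q (a + b)) -> (forall c a, Q a -> Q (c *: a)) ->
  (forall s, Q (T 0 ^+ s)) -> forall a, Q a.
Proof.
move=> QD QZ QT a.
suff: forall s, Q (T 0 ^+ s * a) by move=> /(_ 0); rewrite mul1r.
elim/yh_ind: a => [|a b Qa Qb|c a Qa|[]//|j a Qa] s.
- by rewrite mulr1.
- by rewrite mulrDr; exact: QD.
- by rewrite -scalerAr; exact: QZ.
- have -> : j = last_strand 0 by apply: val_inj => /=; case: j => -[].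
  by rewrite mulrA -exprSr.
Qed.

(** It remains to reduce [g_n a g_n], for [a] in the previous algebra, which is
    itself spanned by products of the same two shapes.  If [a = a1 g_(n-1) a2],
    then [a1] and [a2] commute with [g_n] and the braid relation leaves a single
    [g_n]; if [a = a1 t_n^s], the quadratic relation applies. *)
Lemma last_spanP n x : last_span n x.
Proof.
elim: n x => [|n IHn]; apply: last_span_of_sandwich => a b.
  elim/yh1_ind: a => [a1 a2 S1 S2|c a Sa|s].
  - by rewrite rmorphD /= mulrDr !mulrDl; exact: LastSpanD.
  - by rewrite linearZ /= -scalerAr -!scalerAl; exact: last_spanZ.
  - rewrite -[T 0 ^+ s]mul1r; apply: last_span_quad_framing.
    by rewrite rmorph1 mul1r mulr1.
elim: (IHn a) => [a1 a2 _ S1 _ S2|a1 a2|a1 s].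
- by rewrite rmorphD /= mulrDr !mulrDl; exact: LastSpanD.
- have -> : G n.+1 * incl (incl a1 * G n * incl a2) * G n.+1 * incl b =
    incl (incl a1) * (incl (G n) * G n.+1 * incl (G n)) * incl (incl a2 * b).
    rewrite -last_gen_braid !rmorphM /= !mulrA incl_incl_commG -!mulrA.
    by rewrite [incl (incl a2) * (G n.+1 * _)]mulrA incl_incl_commG !mulrA.
  by apply: last_spanM; exact: LastSpanG.
- by apply: last_span_quad_framing; exact: incl_incl_commG.
Qed.
End Spanning.

(** * Uniqueness of the Markov trace *)

Section LinearForms.
Context {K : fieldType} {V : lmodType K} {f : V -> K}.
Hypothesis f_linear : forall c a b, f (c *: a + b) = c * f a + f b.

Lemma linear_formD a b : f (a + b) = f a + f b.
Proof. by rewrite -[a]scale1r f_linear mul1r scale1r. Qed.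
Lemma linear_formZ c a : f (c *: a) = c * f a.
Proof.
have f0 : f 0 = 0 by apply: (addrI (f 0)); rewrite -linear_formD !addr0.
by rewrite -[c *: a]addr0 f_linear f0 addr0.
Qed.
End LinearForms.

Section Uniqueness.
Context {K : fieldType} {u : K} {d : nat}.
Hypotheses (u_neq0 : u != 0) (d_gt0 : (0 < d)%N).

Local Notation incl := (@yh_incl K u d _).
Local Notation G n := (yg u d (last_gen n)).
Local Notation T n := (yt u d (last_strand n)).

Section OneTrace.
Context {z : K} {x : nat -> K} {tr : forall n, yh u d n -> K}.
Hypothesis trP : markov_trace z x tr.

Lemma markovD n (a b : yh u d n.+1) : tr n.+1 (a + b) = tr n.+1 a + tr n.+1 b.
Proof. exact: (linear_formD (@markov_linear _ _ _ _ _ _ trP n)). Qed.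
Lemma markovZ n c (a : yh u d n.+1) : tr n.+1 (c *: a) = c * tr n.+1 a.
Proof. exact: (linear_formZ (@markov_linear _ _ _ _ _ _ trP n)). Qed.

(** Exponents are reduced modulo [d]; the multiples of [d] are not covered by the
    framing rule of a Markov trace, but by its compatibility with inclusions. *)
Lemma markov_framingX n s (a : yh u d n.+1) :
  tr n.+2 (incl a * T n.+1 ^+ s) =
  (if (s %% d == 0)%N then 1 else x (s %% d)%N) * tr n.+1 a.
Proof.
rewrite -yt_modn; case: eqP => [->|/eqP sd].
  by rewrite mulr1 mul1r (markov_incl trP).
by rewrite (markov_framing trP) // lt0n sd ltn_pmod.
Qed.

(** The framing rule speaks only of strands added to a nonempty braid.  On one
    strand the trace of [t_1^s] is still determined, since [t_1] and [t_2] are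
    conjugate by the invertible element [g_1]. *)
Lemma markov_conj_framing s :
  tr 1%N (T 0 ^+ s) = tr 2 (T 1 ^+ s).
Proof.
rewrite -(markov_incl trP).
have [GV VG] := yh_mulV u_neq0 (yh_gens_eqs u d 2) (last_gen 0).
move: GV VG; set V := (X in _ * X = 1) => GV VG.
rewrite -[X in tr _ X]mul1r -VG -mulrA last_gen_inclT (markov_comm trP).
by rewrite -mulrA GV mulr1.
Qed.

Lemma markov_sandwich n (a b : yh u d n.+1) :
  tr n.+2 (incl a * G n * incl b) = z * tr n.+1 (b * a).
Proof. by rewrite (markov_comm trP) mulrA -rmorphM (markov_gen trP). Qed.
End OneTrace.

(** The trace property turns [a g_n b] into [b a g_n], so on both shapes of the
    spanning set the rules reduce the trace to the previous algebra. *)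
Lemma markov_trace_unique z x x' tr tr' :
  markov_trace z x tr -> markov_trace z x' tr' ->
  (forall s, (0 < s < d)%N -> x s = x' s) ->
  forall n (a : yh u d n.+1), tr n.+1 a = tr' n.+1 a.
Proof.
move=> trP trP' xx'.
have framing n s (a : yh u d n.+1) : tr n.+1 a = tr' n.+1 a ->
    tr n.+2 (incl a * T n.+1 ^+ s) = tr' n.+2 (incl a * T n.+1 ^+ s).
  rewrite (markov_framingX trP) (markov_framingX trP') => ->.
  by case: eqP => // /eqP sd; rewrite xx' // lt0n sd ltn_pmod.
elim=> [|n IHn] a.
  elim/(@yh1_ind K u d): a => [a b ea eb|c a ea|s].
  - by rewrite (markovD trP) (markovD trP') ea eb.
  - by rewrite (markovZ trP) (markovZ trP') ea.
  - rewrite (markov_conj_framing trP) (markov_conj_framing trP').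
    have := framing 0%N s 1; rewrite rmorph1 !mul1r; apply.
    by rewrite (markov_one trP) (markov_one trP').
elim: (last_spanP n a) => [a1 a2 _ e1 _ e2|a1 a2|a1 s].
- by rewrite (markovD trP) (markovD trP') e1 e2.
- by rewrite (markov_sandwich trP) (markov_sandwich trP') IHn.
- exact: framing.
Qed.
End Uniqueness.

(** * Braids and their framings *)

Lemma expsumV n (a : braid n) : expsum a^-1%g = - expsum a.
Proof.
by apply: (addrI (expsum a)); rewrite -expsumM mulgV expsum1 subrr.
Qed.

Section BraidMorphisms.
Context {n : nat}.

(** The values at the [sigma i] are invertible because the maps are
    multiplicative, and inverses are unique; so the maps agree on the inverses of
    the generators as well. *)
Lemma braid_morphism_ext {A : nzRingType} (f f' : braid n -> A) :
  f 1%g = 1 -> (forall a b, f (a * b)%g = f a * f b) ->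
  f' 1%g = 1 -> (forall a b, f' (a * b)%g = f' a * f' b) ->
  (forall i, f (sigma i) = f' (sigma i)) -> f =1 f'.
Proof.
move=> f1 fM f'1 f'M ff'; elim/pgroup_ind=> [|i a IH|i a IH].
- by rewrite f1 f'1.
- by rewrite fM f'M IH; congr (_ * _); exact: ff'.
rewrite fM f'M IH; congr (_ * _); rewrite -/(sigma i).
by rewrite -[LHS]mulr1 -f'1 -(mulgV (sigma i)) f'M -ff' mulrA -fM mulVg f1 mul1r.
Qed.

Lemma expsum_incl (a : braid n) : expsum (braid_incl a) = expsum a.
Proof.
have V b : braid_incl b^-1%g = (braid_incl b)^-1%g.
  by apply: (mulgI (braid_incl b)); rewrite mulgV -braid_inclM mulgV braid_incl1.
elim/pgroup_ind: a => [|i a IH|i a IH]; first by rewrite braid_incl1 !expsum1.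
  by rewrite braid_inclM !expsumM IH -/(sigma i) braid_incl_sigma !expsum_sigma.
rewrite braid_inclM !expsumM IH -/(sigma i) V !expsumV braid_incl_sigma.
by rewrite !expsum_sigma.
Qed.
End BraidMorphisms.

Section Framings.
Context {n : nat}.

Definition total_framing (x : framed n) : int := \sum_j x.1 j.

Lemma total_framingM (x y : framed n) :
  total_framing (x * y)%g = total_framing x + total_framing y.
Proof.
rewrite /total_framing /= [X in _ = _ + X](reindex_perm (braid_perm x.2)).
rewrite -big_split /=.
by apply: eq_bigr => j _; rewrite !ffunE.
Qed.

Lemma total_framing_braid a : total_framing (framed_of_braid a) = 0.
Proof. by apply: big1 => j _; rewrite ffunE. Qed.

Lemma framed_of_braidV (a : braid n) :
  ((framed_of_braid a)^-1 = framed_of_braid a^-1)%g.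
Proof. by congr (_, _); apply/ffunP => k; rewrite !ffunE /= oppr0. Qed.
End Framings.

Lemma total_framing_incl n (x : framed n) :
  total_framing (framed_incl x) = total_framing x.
Proof.
rewrite /total_framing big_ord_recr /= ffunE unlift_none addr0.
apply: eq_bigr => j _; rewrite ffunE.
have -> : widen_ord (leqnSn n) j = lift (last_strand n) j.
  by apply: val_inj; rewrite /= /bump leqNgt ltn_ord.
by rewrite liftK.
Qed.

(** * The Ocneanu trace on braids *)

Section HeckeRep.
Context {K : fieldType} {u : K}.
Hypothesis u_neq0 : u != 0.
Local Notation pi := (@hecke_rep K u u_neq0 _).

Lemma hecke_rep_sigmaV n (i : 'I_n.-1) :
  pi (sigma i)^-1%g = u^-1 *: (hgen u i - (u - 1)%:A).
Proof.
have [_ VH] := hecke_mulV u_neq0 i (hgen_eqs u n).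
set V := u^-1 *: _ in VH *.
rewrite -[LHS]mul1r -VH -mulrA -(hecke_rep_sigma u_neq0) -hecke_repM mulgV.
by rewrite hecke_rep1 mulr1.
Qed.

Lemma hecke_rep_incl n (a : braid n) : pi (braid_incl a) = hecke_incl (pi a).
Proof.
apply: (braid_morphism_ext (fun a => pi (braid_incl a))
  (fun a => hecke_incl (pi a))) a => [|a b||a b|i].
- by rewrite braid_incl1 hecke_rep1.
- by rewrite braid_inclM hecke_repM.
- by rewrite hecke_rep1 rmorph1.
- by rewrite hecke_repM rmorphM.
- by rewrite braid_incl_sigma !hecke_rep_sigma hecke_incl_h.
Qed.

Section Ocneanu.
Context {zeta : K} {tau : forall n, hecke u n -> K}.
Hypothesis tauP : ocneanu_trace zeta tau.

Lemma ocneanuD n (a b : hecke u n.+1) :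
  tau n.+1 (a + b) = tau n.+1 a + tau n.+1 b.
Proof. exact: (linear_formD (@ocneanu_linear _ _ _ _ tauP n)). Qed.
Lemma ocneanuZ n c (a : hecke u n.+1) : tau n.+1 (c *: a) = c * tau n.+1 a.
Proof. exact: (linear_formZ (@ocneanu_linear _ _ _ _ tauP n)). Qed.

(** This is the quadratic relation solved for [h_i^(-1)]. *)
Lemma ocneanu_skein n (i : 'I_n.+1.-1) (a b : braid n.+1) :
  tau n.+1 (pi (a * (sigma i)^-1 * b)%g) =
  u^-1 * (tau n.+1 (pi (a * sigma i * b)%g) - (u - 1) * tau n.+1 (pi (a * b)%g)).
Proof.
rewrite !hecke_repM hecke_rep_sigmaV hecke_rep_sigma -scalerAr -scalerAl ocneanuZ.
congr (_ * _); rewrite mulrBr mulrBl -scaleN1r ocneanuD ocneanuZ mulN1r.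
by rewrite mulr_algr -scalerAl ocneanuZ.
Qed.
End Ocneanu.
End HeckeRep.

(** * From the Yokonuma-Hecke algebra to the Hecke algebra *)

Section Specialization.
Context {K : fieldType} {u : K} {d : nat} {w : K}.
Hypotheses (d_neq0 : d%:R != 0 :> K) (wd : w ^+ d = 1).

Lemma specialization_eqs n :
  yh_relations u d (fun x : 'I_n.-1 + 'I_n =>
    match x with inl i => hgen u i | inr _ => w%:A end).
Proof.
have e1 i : yh_e d (fun _ : 'I_n => w%:A : hecke u n) i = 1.
  rewrite /yh_e (eq_bigr (fun _ => 1)) => [|s _].
    by rewrite sumr_const card_ord -scaler_nat scalerA mulVf // scale1r.
  by rewrite -exprD subnKC 1?ltnW // exprZn wd expr1n scale1r.
have [Hb Hq] := hgen_eqs u n.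
split=> //= [i|j|i|i|i j _ _]; last first.
- by rewrite mulr_algl mulr_algr.
- by rewrite mulr_algl mulr_algr.
- by rewrite mulr_algl mulr_algr.
- by rewrite exprZn wd expr1n scale1r.
- have uA : 1 + (u - 1)%:A = u%:A :> hecke u n.
    by rewrite -[X in X + _]scale1r -scalerDl addrC subrK.
  by rewrite e1 mul1r uA Hq addrC.
Qed.

(** The map is sealed together with its values on the generators, so that
    simplification does not unfold it to the evaluation of terms. *)
Lemma specialization_spec n : {F : {lrmorphism yh u d n -> hecke u n} |
  (forall i, F (yg u d i) = hgen u i) /\ (forall j, F (yt u d j) = w%:A)}.
Proof.
exists (palg_lift (P := AlgPresentation (yh_consistent u d n))
          (specialization_eqs n)).
split=> [i|j]; first exact: (palg_lift_gen _ (inl i)).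
exact: (palg_lift_gen _ (inr j)).
Qed.

Definition specialization n : {lrmorphism yh u d n -> hecke u n} :=
  sval (specialization_spec n).

Local Notation phi := (specialization _).

Lemma specialization_g n (i : 'I_n.-1) : phi (yg u d i) = hgen u i.
Proof. by case: (svalP (specialization_spec n)). Qed.
Lemma specialization_t n (j : 'I_n) : phi (yt u d j) = w%:A.
Proof. by case: (svalP (specialization_spec n)). Qed.

Lemma specialization_incl n (a : yh u d n) :
  phi (yh_incl a) = hecke_incl (phi a).
Proof.
pose F : {lrmorphism yh u d n -> hecke u n.+1} :=
  specialization n.+1 \o @yh_incl _ u d n.
pose G : {lrmorphism yh u d n -> hecke u n.+1} :=
  @hecke_incl _ u n \o specialization n.
apply: (palg_lrmorphism_ext _ F G) a => -[i|j].
  change (phi (yh_incl (yg u d i)) = hecke_incl (phi (yg u d i))).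
  by rewrite yh_incl_g !specialization_g hecke_incl_h.
change (phi (yh_incl (yt u d j)) = hecke_incl (phi (yt u d j))).
by rewrite yh_incl_t !specialization_t linearZ /= rmorph1.
Qed.

Lemma specialized_trace zeta (tau : forall n, hecke u n -> K) :
  ocneanu_trace zeta tau ->
  markov_trace zeta (fun s => w ^+ s) (fun n (a : yh u d n) => tau n (phi a)).
Proof.
move=> tauP; split=> [n c a b|n a|n a b|n|n a|n s a _].
- by rewrite linearP /= (ocneanu_linear tauP).
- by rewrite specialization_incl (ocneanu_incl tauP).
- by rewrite !rmorphM (ocneanu_comm tauP).
- by rewrite rmorph1 (ocneanu_one tauP).
- by rewrite rmorphM /= specialization_incl specialization_g (ocneanu_gen tauP).
- rewrite rmorphM rmorphXn /= specialization_incl specialization_t exprZn expr1n.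
  by rewrite mulr_algr (ocneanuZ tauP) (ocneanu_incl tauP).
Qed.

Hypothesis u_neq0 : u != 0.

Lemma specialization_rep n (a : braid n) :
  phi (yh_rep u_neq0 d a) = hecke_rep u_neq0 a.
Proof.
apply: (braid_morphism_ext (fun a => phi (yh_rep u_neq0 d a))
  (@hecke_rep _ _ u_neq0 n)) a => [|a b||a b|i].
- by rewrite yh_rep1 rmorph1.
- by rewrite yh_repM rmorphM.
- exact: hecke_rep1.
- exact: hecke_repM.
- by rewrite yh_rep_sigma specialization_g hecke_rep_sigma.
Qed.

Hypothesis d_gt0 : (0 < d)%N.

Fact unity_root_neq0 : w != 0.
Proof.
apply/eqP => w0; move/eqP: wd.
by rewrite w0 expr0n gtn_eqF // eq_sym oner_eq0.
Qed.

Lemma unity_root_expz_modz (m : int) : w ^+ `|(m %% d)%Z|%N = w ^ m.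
Proof.
have d0 : d%:Z != 0 by lia.
have -> : w ^ m = w ^ (d%:Z * (m %/ d)%Z) * w ^ (m %% d)%Z.
  by rewrite -expfzDr ?unity_root_neq0 // [d%:Z * _]mulrC -divz_eq.
by rewrite -exprz_exp -exprnP wd exp1rz mul1r exprnP gez0_abs ?modz_ge0.
Qed.

(** All the framing generators become the same scalar, so only the sum of the
    framings survives. *)
Lemma specialization_framed_rep n (x : framed n) :
  phi (framed_rep u_neq0 d x) = w ^ total_framing x *: hecke_rep u_neq0 x.2.
Proof.
rewrite /framed_rep rmorphM /= specialization_rep -mulr_algl; congr (_ * _).
rewrite /yh_framing /total_framing rmorph_prod.
pose P (y : hecke u n) (m : int) := y = (w ^ m)%:A.
apply: (big_rec2 P) => [|j m y _ ->]; first by rewrite /P scale1r.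
rewrite /P rmorphXn /= specialization_t exprZn expr1n unity_root_expz_modz.
by rewrite -scalerAl mul1r scalerA expfzDr ?unity_root_neq0.
Qed.
End Specialization.

(** * The Jones polynomial *)

Lemma ratconstX (R : realType) (c : R[i]) k : ratconst c ^+ k = ratconst (c ^+ k).
Proof. by rewrite /ratconst -rmorphXn -rmorphXn. Qed.

Lemma ratfunc_natr_neq0 (R : realType) d : (0 < d)%N -> d%:R != 0 :> ratfunc R.
Proof.
move=> d_gt0; rewrite -(rmorph_nat (@tofrac {poly R[i]})) tofrac_eq0.
by rewrite -polyC_natr polyC_eq0 Num.Theory.pnatr_eq0 -lt0n.
Qed.

Lemma indet_add1_neq0 (R : realType) : indet R + 1 != 0.
Proof.
rewrite /indet -(rmorph1 (@tofrac {poly R[i]})) -rmorphD tofrac_eq0.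
by rewrite -[1]opprK -polyCN polyXsubC_eq0.
Qed.

Section JonesPolynomial.
Context {R : realType} {L : fieldType} {iota : {rmorphism ratfunc R -> L}}
  {sqrtu : L}.
Hypothesis sqrtuE : sqrtu ^+ 2 = iota (indet R).
Context {tau : forall n : nat, hecke (indet R) n -> ratfunc R}.
Hypothesis tauP : ocneanu_trace (- (indet R + 1)^-1) tau.

Local Notation u := (indet R).
Local Notation V := (jones iota sqrtu tau).

Fact sqrtu_neq0 : sqrtu != 0.
Proof.
apply: contraNneq (indet_neq0 R) => s0.
by rewrite -(fmorph_eq0 iota) -sqrtuE s0 expr0n.
Qed.

Fact sqrtu_add1_neq0 : sqrtu ^+ 2 + 1 != 0.
Proof.
by rewrite sqrtuE -(rmorph1 iota) -rmorphD fmorph_eq0 indet_add1_neq0.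
Qed.

Lemma jones_conj n (a b : braid n.+1) : V (a * b)%g = V (b * a)%g.
Proof.
by rewrite /jones !expsumM addrC !hecke_repM (ocneanu_comm tauP).
Qed.

Lemma jones_skein n (i : 'I_n.+1.-1) (a b : braid n.+1) :
  (iota u)^-1 * V (a * sigma i * b)%g -
    iota u * V (a * (sigma i)^-1 * b)%g =
  (sqrtu - sqrtu^-1) * V (a * b)%g.
Proof.
have s0 := sqrtu_neq0.
rewrite /jones /link_factor !expsumM expsumV expsum_sigma !expfzDr //.
rewrite (ocneanu_skein _ tauP) !(rmorphM, rmorphB, rmorph1, fmorphV) /= -sqrtuE.
rewrite expr1z exprN1.
move: (iota _) (iota _) (sqrtu ^ _) (sqrtu ^ _) (_ ^+ n) => X Y A B F.
by field.
Qed.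

Lemma jones_incl n (a : braid n.+1) :
  V (braid_incl a) = - ((1 + iota u) / sqrtu) * V a.
Proof.
rewrite /jones /link_factor expsum_incl hecke_rep_incl (ocneanu_incl tauP).
by rewrite exprS !mulrA.
Qed.

(** The parameter [-1/(u+1)] is the value for which the factor [z] produced by a
    positive stabilization is compensated by [-(1+u)/sqrt u] and [sqrt u]. *)
Lemma jones_stab n (a : braid n.+1) :
  V (braid_incl a * sigma (last_gen n))%g = V a.
Proof.
have s0 := sqrtu_neq0; have s1 := sqrtu_add1_neq0.
rewrite /jones /link_factor expsumM expsum_incl expsum_sigma expfzDr // expr1z.
rewrite hecke_repM hecke_rep_incl hecke_rep_sigma (ocneanu_gen tauP) /= exprS.
rewrite !(rmorphM, rmorphN, rmorphD, fmorphV, rmorph1) /= -sqrtuE.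
move: (iota _) (sqrtu ^ _) (_ ^+ n) => X A F.
by field; rewrite s0 s1.
Qed.

(** A negative stabilization differs from a positive one by the skein relation,
    whose third term is the closure with one more unknotted component. *)
Lemma jones_stabV n (a : braid n.+1) :
  V (braid_incl a * (sigma (last_gen n))^-1)%g = V a.
Proof.
have s0 := sqrtu_neq0.
have := jones_skein n.+1 (last_gen n) (braid_incl a) 1%g.
rewrite !mulg1 jones_stab jones_incl -sqrtuE.
move: (V _) (V _) => Y X E.
(* The bracket is the left-hand side of the skein relation. *)
have -> : Y = sqrtu ^- 2 *
    (sqrtu ^- 2 * X - (sqrtu ^- 2 * X - sqrtu ^+ 2 * Y)).
  by field.
by rewrite E; field.
Qed.
End JonesPolynomial.

(** * The invariants of framed links *)

Section FramedInvariant.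
Context {R : realType} {L : fieldType} {iota : {rmorphism ratfunc R -> L}}
  {sqrtu : L} {d : nat}.
Hypothesis d_gt0 : (0 < d)%N.
Context {x : nat -> R[i]}.
Hypothesis x_root : forall i : nat, (0 < i < d)%N -> x i ^+ d = 1.
Hypothesis x_pow : forall i : nat, (0 < i < d)%N -> x i = x 1%N ^+ i.
Context {z : ratfunc R}.
Context {tr : forall n : nat, yh (indet R) d n -> ratfunc R}.
Hypothesis trP : markov_trace z (fun s : nat => ratconst (x s)) tr.
Context {tau : forall n : nat, hecke (indet R) n -> ratfunc R}.
Hypothesis tauP : ocneanu_trace z tau.

(** The trace factors through the specialization at [w = x_1].  When [d = 1] the
    value [x 1] is unconstrained, but every framing generator equals [1], which
    forces [w = 1]. *)
Lemma framed_invariantE : exists w : ratfunc R,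
  forall n (a : framed n.+1), framed_yh_invariant iota sqrtu tr a =
    iota (w ^ total_framing a) * jones iota sqrtu tau a.2.
Proof.
pose w : ratfunc R := ratconst (if (1 < d)%N then x 1 else 1).
have wd : w ^+ d = 1.
  rewrite ratconstX; case: ifP => [d1|_].
    by rewrite x_root ?d1 // /ratconst !rmorph1.
  by rewrite expr1n /ratconst !rmorph1.
have d0 := ratfunc_natr_neq0 R d d_gt0.
exists w => n a.
rewrite /framed_yh_invariant /jones mulrCA -rmorphM; congr (_ * iota _).
rewrite (markov_trace_unique (indet_neq0 R) d_gt0 _ _ _ _ _ trP
  (specialized_trace d0 wd _ _ tauP)).
  by rewrite specialization_framed_rep // (ocneanuZ tauP).
move=> s sd; rewrite ratconstX x_pow //; case: ifP => // /negP[]; lia.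
Qed.
End FramedInvariant.

Theorem corollary2
  (R : realType) (L : fieldType) (iota : {rmorphism ratfunc R -> L}) (sqrtu : L)
  (sqrtuE : sqrtu ^+ 2 = iota (indet R))
  (d : nat) (d_gt0 : (0 < d)%N)
  (x : nat -> R[i])
  (x_root : forall i : nat, (0 < i < d)%N -> x i ^+ d = 1)
  (x_pow : forall i : nat, (0 < i < d)%N -> x i = x 1%N ^+ i)
  (tr : forall n : nat, yh (indet R) d n -> ratfunc R)
  (tr_markov : markov_trace (- (indet R + 1)^-1)
                 (fun s : nat => ratconst (x s)) tr)
  (tau : forall n : nat, hecke (indet R) n -> ratfunc R)
  (tau_ocneanu : ocneanu_trace (- (indet R + 1)^-1) tau) :
  (* the invariants of classical links are the Jones polynomial *)
  (forall (n : nat) (a : braid n), (0 < n)%N ->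
     yh_invariant iota sqrtu tr a = jones iota sqrtu tau a)
  /\
  (* the invariants of framed links are analogues of the Jones polynomial *)
  [/\ (* they only depend on the closure *)
      forall (m n : nat) (a : framed m) (b : framed n), framed_markov a b ->
        framed_yh_invariant iota sqrtu tr a = framed_yh_invariant iota sqrtu tr b,
      (* they extend the Jones polynomial *)
      forall (n : nat) (a : braid n), (0 < n)%N ->
        framed_yh_invariant iota sqrtu tr (framed_of_braid a) =
        jones iota sqrtu tau a
    & (* they satisfy the skein relation of the Jones polynomial *)
      forall (n : nat) (i : 'I_n.-1) (a b : framed n), (0 < n)%N ->
        (iota (indet R))^-1 *
          framed_yh_invariant iota sqrtu tr (a * framed_sigma i * b)%g -
        iota (indet R) *
          framed_yh_invariant iota sqrtu tr (a * (framed_sigma i)^-1 * b)%g =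
        (sqrtu - sqrtu^-1) * framed_yh_invariant iota sqrtu tr (a * b)%g].
Proof.
have [w IE] := framed_invariantE (iota := iota) (sqrtu := sqrtu)
  d_gt0 x_root x_pow tr_markov tau_ocneanu.
have extends n (a : braid n) : (0 < n)%N ->
    framed_yh_invariant iota sqrtu tr (framed_of_braid a) =
    jones iota sqrtu tau a.
  case: n a => // n a _.
  by rewrite IE total_framing_braid expr0z rmorph1 mul1r.
split=> [n a n_gt0|].
  by rewrite -extends // /framed_yh_invariant framed_rep_braid.
split=> // [m n a b|[//|n] i a b _].
- elim=> {m n a b} [n a b|n a|n a|m n a b _ -> //|m n p a b c _ -> _ -> //];
    rewrite !IE !total_framingM ?total_framing_incl ?framed_of_braidV
      ?total_framing_braid ?addr0.
  + by rewrite addrC (jones_conj tau_ocneanu).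
  + by rewrite (jones_stab sqrtuE tau_ocneanu).
  + by rewrite (jones_stabV sqrtuE tau_ocneanu).
rewrite !IE !total_framingM framed_of_braidV !total_framing_braid !addr0.
rewrite !(mulrCA _ (iota (w ^ _))) -mulrBr.
by rewrite (jones_skein sqrtuE tau_ocneanu).
Qed.
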